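(* Let $\{X_n\}_{n\in\mathbb Z}$ be a stationary and ergodic finitarily Markovian process with values in a finite or countably infinite alphabet $\mathcal X$, let $\epsilon>0$ be fixed, and let $\mathcal N$ and $\rho_n$ be as constructed in the context. For $x\in\mathcal X$ and $n\in\mathcal N$ define $$\hat q_n(x)=\frac{\#\{\rho_n-1\le i<n: X_{i-\rho_n+1}^i=X_{n-\rho_n+1}^n,\ X_{i+1}=x\}}{\#\{\rho_n-1\le i<n: X_{i-\rho_n+1}^i=X_{n-\rho_n+1}^n\}}.$$ Then for each $x\in\mathcal X$, along $n\in\mathcal N$, $$\left|\hat q_n(x)-P(X_{n+1}=x\mid X_0^n)\right|\to0\quad\text{almost surely,}$$ and the density of $\mathcal N$ is at least $1-\epsilon$, i.e. almost surely $\liminf_{n\to\infty}\frac{|\mathcal N\cap\{0,1,\dots,n-1\}|}{n}\ge1-\epsilon$.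
   Context: Notation: $X_m^n=(X_m,\dots,X_n)$ for $m\le n$, and $X_m^n$ is the empty string if $m>n$; similarly for deterministic strings. $p(x_{-k}^0)=P(X_{-k}^0=x_{-k}^0)$ and $p(y|x_{-k}^0)=P(X_1=y\mid X_{-k}^0=x_{-k}^0)$; for the empty string $\emptyset$, $p(\emptyset)=1$ and $p(y|\emptyset)=P(X_1=y)$. Memory length: $K(X_{-\infty}^0)$ is the smallest $0\le K<\infty$ such that for all $i\ge1$, $y\in\mathcal X$, $z_{-K-i+1}^{-K}\in\mathcal X^i$ one has $p(y|X_{-K+1}^0)=p(y|z_{-K-i+1}^{-K},X_{-K+1}^0)$ provided $p(z_{-K-i+1}^{-K},X_{-K+1}^0,y)>0$; $K(X_{-\infty}^0)=\infty$ if there is no such $K$. The process is finitarily Markovian if $K(X_{-\infty}^0)<\infty$ almost surely. Backward test (a function of $X_{-n}^0$): for $w_{-k+1}^0\in\mathcal X^k$ and $x\in\mathcal X$, $$\hat p_n(x|w_{-k+1}^0)=\frac{\#\{-n+k-1\le t\le -1: X_{t-k+1}^{t+1}=(w_{-k+1}^0,x)\}}{\#\{-n+k-1\le t\le -1: X_{t-k+1}^{t}=w_{-k+1}^0\}}.$$ Fix $0<\gamma<1$ and $0<\beta<\frac{1-\gamma}{2}$. Let $$\mathcal L_k^n=\{x_{-k}^0\in\mathcal X^{k+1}: \#\{-n+k\le t\le 0: X_{t-k}^t=x_{-k}^0\}>n^{1-\gamma}\},$$ $$\hat\Delta_k^n(w_{-k+1}^0)=\max_{1\le i\le n}\ \max_{(z_{-k-i+1}^{-k},w_{-k+1}^0,x)\in\mathcal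 L_{k+i}^n}\left|\hat p_n(x|w_{-k+1}^0)-\hat p_n(x|z_{-k-i+1}^{-k},w_{-k+1}^0)\right|,$$ where the maximum is over $i$, $z_{-k-i+1}^{-k}\in\mathcal X^i$ and $x\in\mathcal X$ with the displayed membership, and $\hat\Delta_k^n(w_{-k+1}^0)=0$ if there are no such triples. Set $NTEST_n(w_{-k+1}^0)=YES$ if $\hat\Delta_k^n(w_{-k+1}^0)\le n^{-\beta}$ and $NO$ otherwise. Forward test: $PTEST_n(w_{-k+1}^0)$ is the function of $X_0^n$ obtained by applying $NTEST_n(w_{-k+1}^0)$ to the data segment $X_0^n$ in place of $X_{-n}^0$ (that is, with $X_{n+j}$ in place of $X_j$ for $-n\le j\le 0$). Construction: let $w(0),w(1),w(2),\dots$ be a list of all finite words over $\mathcal X$ of all lengths such that no word precedes any of its suffixes; $w(0)$ is the empty word; $|w|$ is the length of $w$. Let $A_n^0=\{0,1,\dots,n\}$ and for $i>0$, $A_n^i=\{|w(i)|-1\le j\le n: X_{j-|w(i)|+1}^j=w(i)\}$. Let $\theta_n=\theta_n(\epsilon)<n$ be the minimal $j$ such that $$\frac{\left|\bigcup_{i\le j:\,PTEST_n(w(i))=YES}A_n^i\right|}{n+1}\ge 1-\epsilon/2,$$ and $\theta_n=n$ if no such $j$ exists. Let $\mathcal N$ be the (random) set of those $n$ for which $n\in\bigcup_{i\le\theta_n,\ PTEST_n(w(i))=YES}A_n^i$. For $n\in\mathcal N$ put $\kappa_n=\min\{i\ge0: X_{n-|w(i)|+1}^n=w(i),\ PTEST_n(w(i))=YES\}$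 and $\rho_n=|w(\kappa_n)|$. *)

(* Defs.v *)
From HB Require Import structures.
From mathcomp Require Import all_boot all_order all_algebra.
From mathcomp Require Import all_classical all_reals all_analysis.

Set Implicit Arguments.
Unset Strict Implicit.
Unset Printing Implicit Defensive.

Import Order.TTheory GRing.Theory Num.Theory.
Import numFieldNormedType.Exports.

Local Open Scope classical_set_scope.
Local Open Scope ring_scope.

(* The integers a, a + 1, ..., b in increasing order; empty if b < a. *)
Definition zrange (a b : int) : seq int :=
  if a <= b then [seq a + i%:Z | i <- iota 0 `|b - a|%N.+1] else [::].

(* x_a^b, in chronological order.  A word (w_(-k+1), ..., w_0) is the sequence
   [:: w_(-k+1); ...; w_0]: its last letter is the most recent one, so suffixes
   of a word are suffixes of the sequence. *)
Definition block (A : Type) (x : int -> A) (a b : int) : seq A :=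
  [seq x t | t <- zrange a b].

Definition sample_path (Omega A : Type) (X : int -> Omega -> A) (o : Omega) :
  int -> A := fun t => X t o.

(* A is discrete: all of its subsets are measurable. *)
Definition discrete_process (d : measure_display) (Omega : measurableType d)
    (A : countType) (X : int -> Omega -> A) : Prop :=
  forall (t : int) (B : set A), measurable [set o | B (X t o)].

Definition path_cylinders (A : Type) : set (set (int -> A)) :=
  [set C | exists t a, C = [set x | x t = a]].

(* Product sigma-algebra on the path space; as A is countable, the one-letter
   cylinders generate it. *)
Definition path_measurable (A : countType) (B : set (int -> A)) : Prop :=
  <<s @path_cylinders A >> B.

Definition path_shift (A : Type) (x : int -> A) : int -> A := fun t => x (t + 1).

Definition stationary (d : measure_display) (Omega : measurableType d)
    (R : realType) (P : probability Omega R) (A : countType)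
    (X : int -> Omega -> A) : Prop :=
  forall B : set (int -> A), path_measurable B ->
    P [set o | B (path_shift (sample_path X o))] =
    P [set o | B (sample_path X o)].

Definition ergodic (d : measure_display) (Omega : measurableType d)
    (R : realType) (P : probability Omega R) (A : countType)
    (X : int -> Omega -> A) : Prop :=
  forall B : set (int -> A), path_measurable B ->
    (forall x, B (path_shift x) <-> B x) ->
    P [set o | B (sample_path X o)] = 0%E \/
    P [set o | B (sample_path X o)] = 1%E.

(* P(E | F), with value 0 if P(F) = 0. *)
Definition cond_prob (d : measure_display) (Omega : measurableType d)
    (R : realType) (P : probability Omega R) (E F : set Omega) : R :=
  fine (P (E `&` F)) / fine (P F).

(* p(w) = P(X_(-k+1)^0 = w), k = |w|. *)
Definition word_prob (d : measure_display) (Omega : measurableType d)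
    (R : realType) (P : probability Omega R) (A : countType)
    (X : int -> Omega -> A) (w : seq A) : R :=
  fine (P [set o | block (sample_path X o) (- (size w)%:Z + 1) 0 = w]).

(* p(y | w) = P(X_1 = y | X_(-k+1)^0 = w), k = |w|. *)
Definition next_prob (d : measure_display) (Omega : measurableType d)
    (R : realType) (P : probability Omega R) (A : countType)
    (X : int -> Omega -> A) (y : A) (w : seq A) : R :=
  cond_prob P [set o | X 1 o = y]
    [set o | block (sample_path X o) (- (size w)%:Z + 1) 0 = w].

Definition memory_property (d : measure_display) (Omega : measurableType d)
    (R : realType) (P : probability Omega R) (A : countType)
    (X : int -> Omega -> A) (x : int -> A) (K : nat) : Prop :=
  let w := block x (- K%:Z + 1) 0 in
  forall (i : nat) (y : A) (z : seq A), (1 <= i)%N -> size z = i ->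
    0 < word_prob P X (z ++ w ++ [:: y]) ->
    next_prob P X y w = next_prob P X y (z ++ w).

(* A set of natural numbers: the infimum is its least element, and +oo when the
   set is empty. *)
Definition memory_length (d : measure_display) (Omega : measurableType d)
    (R : realType) (P : probability Omega R) (A : countType)
    (X : int -> Omega -> A) (x : int -> A) : \bar R :=
  ereal_inf [set K%:R%:E | K in [set K : nat | memory_property P X x K]].

Definition finitarily_markovian (d : measure_display)
    (Omega : measurableType d) (R : realType) (P : probability Omega R)
    (A : countType) (X : int -> Omega -> A) : Prop :=
  {ae P, forall o, (memory_length P X (sample_path X o) < +oo)%E}.

(* Empirical conditional probability \hat p_n(a | w) from x_(-n)^0
   (0 / 0 = 0). *)
Definition emp_prob (R : realType) (A : countType) (x : int -> A) (n : nat)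
    (a : A) (w : seq A) : R :=
  let k := (size w)%:Z in
  let times := zrange (- n%:Z + k - 1) (- 1) in
  (count (fun t => block x (t - k + 1) (t + 1) == rcons w a) times)%:R /
  (count (fun t => block x (t - k + 1) t == w) times)%:R.

(* \mathcal L_k^n *)
Definition frequent_words (R : realType) (A : countType) (gamma : R)
    (x : int -> A) (n k : nat) : set (seq A) :=
  [set v | size v = k.+1 /\
     n%:R `^ (1 - gamma) <
     (count (fun t => block x (t - k%:Z) t == v)
        (zrange (- n%:Z + k%:Z) 0))%:R].

(* The set of differences is finite, because frequent words occur in x_(-n)^0,
   so its supremum is a maximum; sup is 0 on the empty set. *)
Definition Delta_hat (R : realType) (A : countType) (gamma : R)
    (x : int -> A) (n : nat) (w : seq A) : R :=
  sup [set r : R | exists (i : nat) (z : seq A) (a : A),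
    [/\ (1 <= i <= n)%N, size z = i,
        frequent_words gamma x n (size w + i) (rcons (z ++ w) a) &
        r = `|emp_prob R x n a w - emp_prob R x n a (z ++ w)|]].

(* true stands for YES. *)
Definition NTEST (R : realType) (A : countType) (gamma beta : R)
    (x : int -> A) (n : nat) (w : seq A) : bool :=
  Delta_hat gamma x n w <= n%:R `^ (- beta).

Definition PTEST (R : realType) (A : countType) (gamma beta : R)
    (x : int -> A) (n : nat) (w : seq A) : bool :=
  NTEST gamma beta (fun t => x (n%:Z + t)) n w.

Definition word_list (A : countType) (w : nat -> seq A) : Prop :=
  [/\ w 0%N = [::],
      injective w,
      forall v, exists i, w i = v &
      forall i j : nat, (i < j)%N -> ~~ suffix (w j) (w i)].

(* A_n^i, a subset of {0, ..., n} *)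
Definition occ_set (A : countType) (w : nat -> seq A) (x : int -> A)
    (n i : nat) : {set 'I_n.+1} :=
  if i == 0%N then [set: 'I_n.+1]%SET else
  [set j : 'I_n.+1 | ((size (w i))%:Z - 1 <= (j : nat)%:Z) &&
     (block x ((j : nat)%:Z - (size (w i))%:Z + 1) (j : nat)%:Z == w i)]%SET.

(* The union of the A_n^i over those i <= j for which PTEST_n(w(i)) = YES. *)
Definition covered (R : realType) (A : countType) (gamma beta : R)
    (w : nat -> seq A) (x : int -> A) (n j : nat) : {set 'I_n.+1} :=
  (\bigcup_(i < j.+1 | PTEST gamma beta x n (w i)) occ_set w x n i)%SET.

(* The least j < n that satisfies the inequality, and n if there is none. *)
Definition theta (R : realType) (A : countType) (gamma beta eps : R)
    (w : nat -> seq A) (x : int -> A) (n : nat) : nat :=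
  find (fun j => 1 - eps / 2 <= #|covered gamma beta w x n j|%:R / n.+1%:R)
    (iota 0 n).

(* n belongs to \mathcal N; ord_max is n as an element of {0, ..., n}. *)
Definition good_time (R : realType) (A : countType) (gamma beta eps : R)
    (w : nat -> seq A) (x : int -> A) (n : nat) : bool :=
  ord_max \in covered gamma beta w x n (theta gamma beta eps w x n).

(* Meaningful for good times; 0 when there is no such i. *)
Definition kappa (R : realType) (A : countType) (gamma beta : R)
    (w : nat -> seq A) (x : int -> A) (n : nat) : nat :=
  match pselect (exists i : nat,
    (block x (n%:Z - (size (w i))%:Z + 1) n%:Z == w i) &&
    PTEST gamma beta x n (w i)) with
  | left exi => ex_minn exi
  | right _ => 0%N
  end.

Definition rho (R : realType) (A : countType) (gamma beta : R)
    (w : nat -> seq A) (x : int -> A) (n : nat) : nat :=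
  size (w (kappa gamma beta w x n)).

(* \hat q_n(a) (0 / 0 = 0). *)
Definition q_hat (R : realType) (A : countType) (gamma beta : R)
    (w : nat -> seq A) (x : int -> A) (n : nat) (a : A) : R :=
  let r := (rho gamma beta w x n)%:Z in
  let same i := block x (i - r + 1) i == block x (n%:Z - r + 1) n%:Z in
  let times := zrange (r - 1) (n%:Z - 1) in
  (count (fun i => same i && (x (i + 1) == a)) times)%:R /
  (count same times)%:R.

(* P(X_(n+1) = a | X_0^n) at the outcome o. *)
Definition next_prob_given_past (d : measure_display)
    (Omega : measurableType d) (R : realType) (P : probability Omega R)
    (A : countType) (X : int -> Omega -> A) (n : nat) (a : A) (o : Omega) : R :=
  cond_prob P [set o' | X (n%:Z + 1) o' = a]
    [set o' | block (sample_path X o') 0 n%:Z = block (sample_path X o) 0 n%:Z].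

(* Main.v *)
Require Import Defs.
From HB Require Import structures.
From mathcomp Require Import all_boot all_order all_algebra.
From mathcomp Require Import all_classical all_reals all_analysis.
From mathcomp Require Import measurable_realfun.
From mathcomp Require Import ring lra zify.

Import Order.TTheory GRing.Theory Num.Theory.
Import numFieldNormedType.Exports.
Set Implicit Arguments.
Unset Strict Implicit.
Unset Printing Implicit Defensive.

Local Open Scope classical_set_scope.
Local Open Scope ring_scope.
(** Call a word [u] a memory word if lengthening it to the left does not change
    the conditional law of the next letter.  A finitarily Markovian process
    almost surely ends in a memory word, so finitely many memory words cover a
    fraction greater than [1 - eps / 2] of the times ([memory_coverage]).  The
    theorem follows once the test is known to be consistent: for each fixed
    word, almost surely, it eventually says YES exactly when the word is a
    memory word ([PTEST_ae]).  Indeed [theta] is then eventually bounded by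
    some [J], so that only the words [w 0], ..., [w J], on which the test has
    settled, matter afterwards.  At a good time the selected word is a memory
    word that ends the past, hence the true conditional probability is the
    next-letter probability of that word ([next_prob_given_pastE]), and the
    estimate converges to it by the ergodic theorem.  For the density, let [j]
    be the least index for which the memory words up to [w j] have probability
    at least [1 - eps] of ending the past.  A smaller index covers less than
    [1 - eps / 2] in the long run, so [theta] is eventually at least [j] and
    all occurrences of these memory words are good times.

    Two probabilistic facts are needed.

    The ergodic theorem for indicator functions ([visits_cvg_ae]).  The set
    where the visit counts exceed [q * n] by arbitrarily large amounts is
    exactly shift-invariant, hence has probability 0 or 1, and if it has
    probability 1 then a greedy covering of a long time interval by
    intervals of high visit density shows that the visited set has
    probability at least [q] ([unbounded_excess_le]).

    Consistency of the test.  If [u] is not a memory word, an extension with a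
    different next-letter law occurs with positive frequency and the test
    detects it by the ergodic theorem.  If [u] is a memory word, the empirical
    probabilities after all frequent extensions of [u] must be close to the
    next-letter probability of [u] simultaneously.  The alphabet may be
    infinite, so a union bound over extensions needs deviation probabilities
    that are summable over words.  For an extension [v] followed by a letter
    [a], let [N] count the occurrences of [v] and [C] those of [v a], and let
    [p] be the next-letter probability.  Then
    exp (lam (C - p N) - 2 lam^2 N) is a supermartingale; multiplied by [C], its
    expectation is at most a polynomial in the sample size times the
    probability of the word [v a] ([integral_tilt_occs]).  As the words of a
    given length are disjoint events, these bounds sum over all words of that
    length ([union_bound_fibers], [some_deviant_prob]), and the resulting
    stretched exponentials are summable in the sample size, so that the
    Borel-Cantelli lemma applies ([frequent_successors_ae]). *)

(** * Pointwise ergodic theorem for visit frequencies *)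

Section birkhoff.
Context {d : measure_display} {T : measurableType d} {R : realType}.
Variables (P : probability T R) (f : T -> T).

Definition visits (B : set T) (n : nat) (x : T) : nat :=
  count (fun t => iter t f x \in B) (iota 0 n).

Lemma visits_le_size B n x : (visits B n x <= n)%N.
Proof. by rewrite (leq_trans (count_size _ _)) ?size_iota. Qed.

Lemma visitsC B n x : (visits (~` B) n x)%:R = n%:R - (visits B n x)%:R :> R.
Proof.
have := count_predC (fun t => iter t f x \in B) (iota 0 n).
rewrite size_iota => h; rewrite /visits.
apply/eqP; rewrite eq_sym subr_eq -natrD -[X in X%:R == _]h addnC.
by apply/eqP; congr (_ + _)%:R; apply: eq_count => t /=; rewrite in_setC.
Qed.

Lemma visitsS B n x : visits B n.+1 x = ((x \in B) + visits B n (f x))%N.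
Proof.
rewrite /visits /=; congr addn.
rewrite -(addn0 1%N) iotaDl count_map; apply: eq_count => t /=.
by rewrite -iterS iterSr.
Qed.

Lemma visits_mono B C n x : B `<=` C -> (visits B n x <= visits C n x)%N.
Proof. by move=> BC; apply: sub_count => t; rewrite !inE; exact: BC. Qed.

(** Starting from [t], jump over successive intervals of length at most [M] in
    which the density of [b] is at least [q]; only the last [M] times of an
    interval of length [L] may be left uncovered. *)
Lemma greedy_cover (b : nat -> bool) (q : R) (M : nat) : 0 <= q ->
  (forall t, exists m, [/\ (1 <= m)%N, (m <= M)%N &
     q * m%:R <= (count (fun i => b (t + i)%N) (iota 0 m))%:R]) ->
  forall L t, q * (L%:R - M%:R) <= (count (fun i => b (t + i)%N) (iota 0 L))%:R.
Proof.
move=> q0 H L; elim/ltn_ind: L => L IH t.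
have [LM|ML] := leqP L M.
  by rewrite (@le_trans _ _ 0)// mulr_ge0_le0 // subr_le0 ler_nat.
have [m [m1 mM hm]] := H t.
have mL : (m <= L)%N by lia.
have e : L = (m + (L - m))%N by lia.
rewrite [in iota _ _]e iotaD count_cat add0n natrD.
rewrite (_ : iota m (L - m) = map (addn m) (iota 0 (L - m))); last first.
  by rewrite -iotaDl addn0.
rewrite count_map.
rewrite (_ : count (preim _ _) _ = count (fun i => b (t + m + i)%N) (iota 0 (L - m))); last first.
  by apply: eq_count => i /=; rewrite addnA.
have := IH (L - m)%N _ (t + m)%N; rewrite natrB// => /(_ ltac:(lia)) h.
apply: le_trans (lerD hm h); rewrite -mulrDr; apply: ler_wpM2l => //; lra.
Qed.

Hypothesis mf : measurable_fun setT f.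
Hypothesis Pf : forall B, measurable B -> P (f @^-1` B) = P B.

Lemma measurable_iter t : measurable_fun setT (iter t f).
Proof.
elim: t => [|t IH]; first exact: measurable_id.
rewrite (_ : iter t.+1 f = f \o iter t f) //; exact: measurableT_comp.
Qed.

Lemma measurable_iter_preimage t B : measurable B -> measurable (iter t f @^-1` B).
Proof. by move=> mB; rewrite -[X in measurable X]setTI; exact: measurable_iter. Qed.

Lemma iter_preserving t B : measurable B -> P (iter t f @^-1` B) = P B.
Proof.
move=> mB; elim: t => [|t IH] //.
rewrite -IH -[in RHS]Pf; last exact: measurable_iter_preimage.
by congr (P _); apply/seteqP; split => x /=; rewrite -iterS iterSr.
Qed.

Lemma visits_sum B n x :
  (visits B n x)%:R = \sum_(t < n) (\1_(iter t f @^-1` B) x) :> R.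
Proof.
rewrite /visits -sum1_count natr_sum big_mkcond /= -[n in iota 0 n]subn0.
rewrite -/(index_iota 0 n) big_mkord; apply: eq_bigr => t _.
have -> : \1_(iter t f @^-1` B) x = ((iter t f x \in B)%:R : R).
  by rewrite indicE; congr (_%:R); apply/idP/idP; rewrite !inE.
by case: ifP.
Qed.

Lemma measurable_visits B n : measurable B ->
  measurable_fun setT (fun x => (visits B n x)%:R : R).
Proof.
move=> mB; under eq_fun do rewrite visits_sum.
apply: measurable_sum => t; apply: measurable_indic.
exact: measurable_iter_preimage.
Qed.

Lemma measurable_visits_above B n (c : R) : measurable B ->
  measurable [set x | c < (visits B n x)%:R].
Proof.
move=> mB; rewrite (_ : [set x | _] = setT `&` (fun x => (visits B n x)%:R : R) @^-1` `]c, +oo[).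
  by apply: measurable_visits.
by apply/seteqP; split => x /=; rewrite in_itv /= andbT => //; case.
Qed.

Lemma measurable_visits_below B n (c : R) : measurable B ->
  measurable [set x | (visits B n x)%:R < c].
Proof.
move=> mB; rewrite (_ : [set x | _] = setT `&` (fun x => (visits B n x)%:R : R) @^-1` `]-oo, c[).
  by apply: measurable_visits.
by apply/seteqP; split => x /=; rewrite in_itv /= => //; case.
Qed.

Lemma integral_visits B n : measurable B ->
  (\int[P]_x ((visits B n x)%:R : R)%:E = n%:R%:E * P B)%E.
Proof.
move=> mB.
under eq_integral do rewrite visits_sum -sumEFin.
rewrite ge0_integral_sum //=.
- rewrite (eq_bigr (fun _ => P B)).
    rewrite -(fineK (fin_num_measure P B mB)) sumEFin sumr_const card_ord.
    by rewrite -EFinM mulr_natl.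
  move=> t _; rewrite integral_indic ?setIT //; first exact: iter_preserving.
  exact: measurable_iter_preimage.
- move=> t; apply/measurable_EFinP/measurable_indic.
  exact: measurable_iter_preimage.
Qed.


Lemma measurable_unbounded_excess B (q : R) : measurable B ->
  measurable [set x | forall k : nat, exists n, q * n%:R + k%:R < (visits B n x)%:R].
Proof.
move=> mB; rewrite (_ : [set x | _] =
    \bigcap_k \bigcup_n [set x | q * n%:R + k%:R < (visits B n x)%:R]).
  apply: bigcapT_measurable => k; apply: bigcupT_measurable => n.
  exact: measurable_visits_above.
apply/seteqP; split => y h k; first by move=> _; have [n] := h k; exists n.
by have [n _] := h k I; exists n.
Qed.

(** Almost every point has some first time at which the visit density reaches
    [q].  Adding to [B] the set [D M] of points for which this takes longer
    than [M] steps makes the greedy covering available at all points.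
    Integrating the covering bound over a long interval gives
    [q <= P B + P (D M)], and [P (D M)] tends to 0. *)
Lemma unbounded_excess_le B (q : R) : measurable B ->
  P [set x | forall k : nat, exists n, q * n%:R + k%:R < (visits B n x)%:R] = 1%E ->
  (q%:E <= P B)%E.
Proof.
move=> mB; set U := [set x | _] => PU.
have [q0|q0] := ltP q 0.
  by rewrite (le_trans _ (measure_ge0 P B))// lee_fin ltW.
have [x Ux] : U !=set0.
  by apply/set0P/eqP => U0; move: PU; rewrite U0 measure0 => /eqP; rewrite eqe eq_sym oner_eq0.
have q1 : q <= 1.
  have [n /= h] := Ux 0%N.
  have := visits_le_size B n x; rewrite -(ler_nat R) => h2.
  rewrite leNgt; apply/negP => q1; have : (1 : R) * n%:R <= q * n%:R.
    by rewrite ler_wpM2r // ltW.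
  lra.
pose D M := [set x | forall m, (1 <= m <= M)%N -> (visits B m x)%:R < q * m%:R].
have mD M : measurable (D M).
  rewrite (_ : D M = \bigcap_(m in [set m | (1 <= m <= M)%N])
      [set x | (visits B m x)%:R < q * m%:R]) //.
  by apply: bigcap_measurableType => m _; exact: measurable_visits_below.
(* Points of [D M.+1] count as visits, so the interval of length 1 works there. *)
have main M : (q%:E <= P (B `|` D M.+1))%E.
  set B' := B `|` D M.+1.
  have mB' : measurable B' by exact: measurableU.
  rewrite -(fineK (fin_num_measure P B' mB')) lee_fin.
  have bound L : q * (L%:R - M.+1%:R) <= L%:R * fine (P B').
    have [LM|ML] := leqP L M.+1.
      rewrite (@le_trans _ _ 0)// ?mulr_ge0_le0 // ?subr_le0 ?ler_nat //.
      by rewrite mulr_ge0 // fine_ge0.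
    rewrite -lee_fin [X in (_ <= X)%E]EFinM fineK ?fin_num_measure // -integral_visits //.
    apply: le_trans (_ : (\int[P]_x (cst (q * (L%:R - M.+1%:R))%:E x) <= _)%E).
      by rewrite integral_cst //= probability_setT mule1.
    have greedy x0 : q * (L%:R - M.+1%:R) <= (visits B' L x0)%:R.
      apply: (@greedy_cover (fun i => iter i f x0 \in B') q M.+1 q0 _ L 0%N) => t.
      have [Dt|nDt] := pselect (D M.+1 (iter t f x0)).
        exists 1%N; split => //=; rewrite mulr1 addn0 addn0.
        by rewrite mem_set //; right.
      have [m [/andP[m1 mM] hm]] : exists m, (1 <= m <= M.+1)%N /\
          q * m%:R <= (visits B m (iter t f x0))%:R.
        apply: contrapT => /forallNP h; apply: nDt => m mM; rewrite ltNge; apply/negP => hm.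
        exact: (h m).
      exists m; split => //; apply: (le_trans hm); rewrite ler_nat.
      apply: leq_trans (visits_mono m (iter t f x0) (_ : B `<=` B')) _.
        by move=> y; left.
      by apply: eq_leq; apply: eq_count => i /=; rewrite -iterD addnC.
    apply: ge0_le_integral => //.
    - by move=> y _; rewrite lee_fin mulr_ge0 // subr_ge0 ler_nat ltnW.
    - by apply/measurable_EFinP; exact: measurable_visits.
    - by move=> y _; rewrite lee_fin; exact: greedy.
  rewrite leNgt; apply/negP => pq.
  have := bound (Num.bound (q * M.+1%:R / (q - fine (P B')))).
  set L := Num.bound _.
  have : q * M.+1%:R / (q - fine (P B')) < L%:R.
    by apply: archi_boundP; rewrite divr_ge0 ?mulr_ge0 ?subr_ge0 // ltW.
  rewrite ltr_pdivrMr ?subr_gt0 //; nra.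
have mU : measurable U by exact: measurable_unbounded_excess.
have PU0 : P (~` U) = 0%E by rewrite probability_setC // PU subee.
have D0 : P (\bigcap_M D M.+1) = 0%E.
  apply: (@subset_measure0 _ _ _ P _ (~` U)).
  - by apply: bigcap_measurableType.
  - exact: measurableC.
  - move=> y Dy Uy; have [n] := Uy 0%N; rewrite addr0.
    case: n => [|n]; first by rewrite mulr0 ltxx.
    by apply/negP; rewrite -leNgt ltW // (Dy n) //= leqnn.
  - exact: PU0.
have cvgD : P (D M.+1) @[M --> \oo] --> 0%E.
  rewrite -D0; apply: nonincreasing_cvg_mu => //.
  - by rewrite ltey_eq fin_num_measure.
  - by apply: bigcap_measurableType.
  - move=> m n mn; apply/subsetPset => y Dy k /andP[k1 kn]; apply: Dy.
    by rewrite k1 (leq_trans kn).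
have : (P B + P (D M.+1)) @[M --> \oo] --> (P B + 0)%E.
  by apply: cvgeD => //; [rewrite fin_num_adde_defl|exact: cvg_cst].
rewrite adde0 => h; rewrite -(cvg_lim _ h) //.
apply: lime_ge; first by apply/cvg_ex; eexists; exact: h.
by apply: nearW => M; rewrite (le_trans (main M))// measureU2.
Qed.

Hypothesis erg : forall B, measurable B -> f @^-1` B = B -> P B = 0%E \/ P B = 1%E.

(** Stated with an unbounded excess rather than with a limit superior, because
    the exceptional set is then invariant on the nose: one step of [f] changes
    the excess by a bounded amount. *)
Lemma visits_le_ae B (q : R) : measurable B -> (P B < q%:E)%E ->
  {ae P, forall x, exists k : nat, forall n, (visits B n x)%:R <= q * n%:R + k%:R}.
Proof.
move=> mB Bq; set U := [set x | forall k : nat, exists n, q * n%:R + k%:R < (visits B n x)%:R].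
have mU : measurable U by exact: measurable_unbounded_excess.
have fU : f @^-1` U = U.
  have [K qK] : exists K : nat, `|q| <= K%:R.
    by exists (Num.bound `|q|); rewrite ltW // archi_boundP.
  have {}qK : - K%:R <= q <= K%:R by rewrite -ler_norml.
  apply/seteqP; split => x Ux k.
    have [n hn] := Ux (k + K)%N; exists n.+1.
    rewrite visitsS natrD (lt_le_trans (_ : _ < (visits B n (f x))%:R)) //; last first.
      by rewrite lerDr ler0n.
    by apply: le_lt_trans hn; rewrite -natr1 natrD; lra.
  have [[|n] hn] := Ux (k + K.+1)%N; move: hn; rewrite natrD.
    by rewrite mulr0 add0r ltNge -natrD ler0n.
  rewrite visitsS natrD -[n.+1%:R]natr1 -[K.+1%:R]natr1 => hn; exists n.
  have : ((x \in B)%:R : R) <= 1 by rewrite lern1 leq_b1.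
  lra.
have PU : P U = 0%E.
  have [//|PU1] := erg mU fU.
  by have := unbounded_excess_le mB PU1; rewrite leNgt Bq.
exists U; split => // x /= h k.
apply: contrapT => /forallNP h2; apply: h; exists k => n.
by rewrite leNgt; apply/negP; exact: h2.
Qed.

Theorem visits_cvg_ae B : measurable B ->
  {ae P, forall x, (visits B n x)%:R / n%:R @[n --> \oo] --> fine (P B)}.
Proof.
move=> mB; set p := fine (P B).
have PB : P B = p%:E by rewrite fineK ?fin_num_measure.
have le1 : {ae P, forall x, forall m : nat, exists k : nat, forall n,
    (visits B n x)%:R <= (p + m.+1%:R^-1) * n%:R + k%:R}.
  by apply: ae_foralln => m; apply: visits_le_ae => //; rewrite PB lte_fin ltrDl.
have le2 : {ae P, forall x, forall m : nat, exists k : nat, forall n,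
    (visits (~` B) n x)%:R <= (1 - p + m.+1%:R^-1) * n%:R + k%:R}.
  apply: ae_foralln => m; apply: visits_le_ae; first exact: measurableC.
  by rewrite probability_setC // PB -EFinB lte_fin ltrDl.
apply: filterS2 le1 le2 => x h1 h2; apply/cvgrPdist_le => e e0.
have [m me] : exists m : nat, m.+1%:R^-1 <= e / 2.
  exists (Num.bound (2 / e)); rewrite invf_ple ?posrE ?divr_gt0 //.
  have /archi_boundP : 0 <= 2 / e by rewrite divr_ge0 // ltW.
  by rewrite invf_div => /ltW h; rewrite (le_trans h) // ler_nat.
have [k1 {}h1] := h1 m; have [k2 {}h2] := h2 m.
near=> n.
have n0 : (0 : R) < n%:R by rewrite ltr0n; near: n; exact: nbhs_infty_gt.
have hk : (k1 + k2)%:R <= e / 2 * n%:R.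
  rewrite mulrC -ler_pdivrMr ?divr_gt0 //; near: n; exact: nbhs_infty_ger.
have := h1 n; have := h2 n; rewrite visitsC.
have : m.+1%:R^-1 * n%:R <= e / 2 * n%:R by rewrite ler_wpM2r // ltW.
move: hk; rewrite natrD.
have : (0 : R) <= k1%:R by []. have : (0 : R) <= k2%:R by [].
set v := (visits B n x)%:R; set i := m.+1%:R^-1; move=> k20 k10 hk hi g2 g1.
rewrite (_ : p - _ = (p * n%:R - v) / n%:R); last first.
  by rewrite mulrBl mulfK // lt0r_neq0.
rewrite normrM normfV (gtr0_norm n0) ler_pdivrMr // ler_norml; apply/andP; split; lra.
Unshelve. all: by end_near. Qed.

End birkhoff.
(** * Occurrences of words along a path *)

Section words.
Context {A : countType}.
Implicit Types (x : int -> A) (u v : seq A).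

(** Positions are lengths of prefixes: [past x s] consists of [x 0], ...,
    [x (s - 1)], and [occ u x s] says that it ends in [u].  The empty word thus
    also occurs at [s = 0], before any letter, which matches the range of
    times in the empirical probabilities. *)
Definition past x (s : nat) : seq A := mkseq (fun i : nat => x i%:Z) s.

Definition occ u x (s : nat) : bool := suffix u (past x s).

Definition occs u x (n : nat) : nat := count (occ u x) (iota 0 n).

Lemma size_past x s : size (past x s) = s.
Proof. exact: size_mkseq. Qed.

Lemma pastS x s : past x s.+1 = rcons (past x s) (x s%:Z).
Proof. by rewrite /past mkseqS. Qed.

Lemma zrange_iota (a b : int) (m : nat) :
  b = a + m%:Z - 1 \/ m = 0%N /\ b < a ->
  zrange a b = [seq a + i%:Z | i <- iota 0 m].
Proof.
rewrite /zrange => -[->|[-> ba]]; last by rewrite leNgt ba.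
case: m => [|m]; first by rewrite ifF //; lia.
rewrite ifT; last lia.
by congr (map _ (iota _ _)); lia.
Qed.

Lemma block_mkseq x (a b : int) (m : nat) : b = a + m%:Z - 1 ->
  block x a b = mkseq (fun i : nat => x (a + i%:Z)) m.
Proof. by move=> h; rewrite /block (@zrange_iota _ _ m) -?map_comp; [|left]. Qed.

Lemma count_zrange (p : pred int) (a b : int) (m : nat) :
  b = a + m%:Z - 1 \/ m = 0%N /\ b < a ->
  count p (zrange a b) = count (fun i : nat => p (a + i%:Z)) (iota 0 m).
Proof. by move=> h; rewrite (zrange_iota h) count_map. Qed.

Lemma occE u x s : (size u <= s)%N ->
  occ u x s = (block x (s%:Z - (size u)%:Z) (s%:Z - 1) == u).
Proof.
move=> us; rewrite /occ suffixE size_past.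
rewrite (@block_mkseq _ _ _ (size u)); last lia.
congr (_ == _); rewrite /past /mkseq -map_drop drop_iota add0n.
rewrite subKn // -[X in iota X _]addn0 iotaDl -map_comp; apply: eq_map => i /=.
by congr x; lia.
Qed.

Lemma occ_small u x s : (s < size u)%N -> occ u x s = false.
Proof.
by move=> us; apply/negbTE/negP => /size_suffix; rewrite size_past leqNgt us.
Qed.

Lemma occ_rcons u a x s : occ (rcons u a) x s.+1 = occ u x s && (x s%:Z == a).
Proof. by rewrite /occ pastS suffix_rcons eq_sym andbC. Qed.

Lemma count_iota_drop (p : pred nat) k n : (forall s, (s < k)%N -> p s = false) ->
  count p (iota 0 n) = count (fun i => p (k + i)%N) (iota 0 (n - k)).
Proof.
move=> pk; have [nk|kn] := leqP n k.
  rewrite (eqP (_ : (n - k)%N == 0%N)) ?subn_eq0 //=.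
  apply/eqP; rewrite eqn0Ngt -has_count; apply/hasPn => s.
  by rewrite mem_iota => /andP[_ sn]; rewrite pk //; lia.
rewrite -{1}(subnKC (ltnW kn)) iotaD count_cat.
rewrite (_ : count p (iota 0 k) = 0%N); last first.
  apply/eqP; rewrite eqn0Ngt -has_count; apply/hasPn => s.
  by rewrite mem_iota => /andP[_ sn]; rewrite pk.
by rewrite !add0n -[X in iota X _]addn0 iotaDl count_map.
Qed.

Lemma occs_block u x n : occs u x n =
  count (fun i : nat => block x i%:Z (i%:Z + (size u)%:Z - 1) == u)
        (iota 0 (n - size u)).
Proof.
rewrite /occs (@count_iota_drop _ (size u)) => [|s]; last exact: occ_small.
apply: eq_count => i /=; rewrite occE ?leq_addr //.
by congr (block _ _ _ == _); lia.
Qed.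

Lemma block_shift x (n : int) a b :
  block (fun t => x (n + t)) a b = block x (n + a) (n + b).
Proof.
rewrite /block /zrange (_ : (n + a <= n + b) = (a <= b)); last lia.
case: ifP => // _; rewrite -!map_comp (_ : n + b - (n + a) = b - a); last lia.
by apply: eq_map => i /=; rewrite addrA.
Qed.

(** The occurrences of [rcons u a] are counted up to one position later than
    those of [u], since each of them ends one letter after an occurrence of
    [u]. *)
Lemma emp_probE (R : realType) x n a u :
  emp_prob R (fun t => x (n%:Z + t)) n a u =
  (occs (rcons u a) x n.+2)%:R / (occs u x n.+1)%:R.
Proof.
rewrite /emp_prob !occs_block size_rcons subSS.
have h : (-1 : int) = - n%:Z + (size u)%:Z - 1 + (n.+1 - size u)%N%:Z - 1 \/
   (n.+1 - size u)%N = 0%N /\ (-1 : int) < - n%:Z + (size u)%:Z - 1.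
  lia.
rewrite !(count_zrange _ h); congr (_%:R / _%:R); apply: eq_count => i /=.
  by rewrite block_shift; congr (block _ _ _ == _); lia.
by rewrite block_shift; congr (block _ _ _ == _); lia.
Qed.

Lemma frequent_wordsE (R : realType) (gamma : R) x n k v :
  frequent_words gamma (fun t => x (n%:Z + t)) n k v <->
  size v = k.+1 /\ n%:R `^ (1 - gamma) < (occs v x n.+2)%:R.
Proof.
rewrite /frequent_words /=.
suff h : size v = k.+1 -> count (fun t => block (fun t => x (n%:Z + t)) (t - k%:Z) t == v)
   (zrange (- n%:Z + k%:Z) 0) = occs v x n.+2.
  by split => -[sv]; rewrite h.
move=> sv; rewrite occs_block sv (@count_zrange _ _ _ (n.+1 - k)); last lia.
rewrite subSS; apply: eq_count => i /=.
by rewrite block_shift; congr (block _ _ _ == _); lia.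
Qed.

Lemma q_hatE (R : realType) (gamma beta : R) w x n a :
  let u := w (kappa gamma beta w x n) in occ u x n.+1 ->
  q_hat gamma beta w x n a =
  (occs (rcons u a) x n.+2)%:R / (occs u x n.+1)%:R.
Proof.
move=> u un; rewrite /q_hat /rho -/u.
have us : (size u <= n.+1)%N by rewrite leqNgt; apply: contraL un => /occ_small ->.
have -> : block x (n%:Z - (size u)%:Z + 1) n%:Z = u.
  move: un; rewrite occE // => /eqP e; rewrite -[RHS]e.
  by congr (block _ _ _); lia.
rewrite !occs_block size_rcons subSS.
have h : n%:Z - 1 = (size u)%:Z - 1 + (n.+1 - size u)%N%:Z - 1 \/
   (n.+1 - size u)%N = 0%N /\ n%:Z - 1 < (size u)%:Z - 1 by lia.
rewrite !(count_zrange _ h); congr (_%:R / _%:R); apply: eq_count => i /=; last first.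
  by congr (block _ _ _ == _); lia.
rewrite (@block_mkseq _ _ _ (size u)); last lia.
rewrite (@block_mkseq _ _ _ (size u).+1); last lia.
rewrite mkseqS eqseq_rcons; congr (_ && _); last by congr (x _ == _); lia.
by congr (_ == _); apply: eq_mkseq => j; congr x; lia.
Qed.

Lemma mem_occ_set w x n i (j : 'I_n.+1) : w 0%N = [::] ->
  (j \in occ_set w x n i) = occ (w i) x j.+1.
Proof.
move=> w0; rewrite /occ_set; case: eqP => [->|_].
  by rewrite w0 inE /occ suffix0s.
rewrite inE; have [us|us] := leqP (size (w i)) j.+1.
  by rewrite occE // (_ : _ <= _ = true) /=; [congr (block _ _ _ == _)|]; lia.
by rewrite occ_small // (_ : _ <= _ = false) //; lia.
Qed.

Lemma iter_path_shift t x : iter t (@path_shift A) x = fun s => x (s + t%:Z).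
Proof.
elim: t => [|t IH] /=; first by apply/funext => s; rewrite addr0.
by rewrite IH /path_shift; apply/funext => s; congr x; lia.
Qed.

Lemma occ_iter_shift u x t : (size u <= t.+1)%N ->
  occ u x t.+1 = (block (iter t (@path_shift A) x) (- (size u)%:Z + 1) 0 == u).
Proof.
move=> us; rewrite occE // iter_path_shift.
rewrite (_ : (fun s => x (s + t%:Z)) = (fun s => x (t%:Z + s))).
  by rewrite block_shift; congr (block _ _ _ == _); lia.
by apply/funext => s; rewrite addrC.
Qed.

End words.
(** * Word frequencies of a stationary ergodic process *)

Lemma cvg_ratio_bounded_diff (R : realType) (f g : nat -> nat) (C : nat) (p : R) :
  (forall n, (f n <= g n + C)%N) -> (forall n, (g n <= f n + C)%N) ->
  (f n)%:R / n%:R @[n --> \oo] --> p -> (g n)%:R / n%:R @[n --> \oo] --> p.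
Proof.
move=> fg gf /cvgrPdist_le H; apply/cvgrPdist_le => e e0.
have e2 : 0 < e / 2 by rewrite divr_gt0.
have := H _ e2; apply: filterS2 (_ : \forall n \near \oo, C%:R / (e / 2) <= n%:R /\ (0 < n)%N).
  move=> n /= [Cn n0] h.
  have n0' : (0 : R) < n%:R by rewrite ltr0n.
  apply: le_trans (ler_distD ((f n)%:R / n%:R) _ _) _.
  rewrite [leRHS](splitr e) lerD // -mulrBl normrM normfV (gtr0_norm n0').
  rewrite ler_pdivrMr // mulrC -ler_pdivrMr //.
  apply: le_trans Cn; rewrite ler_pM2r ?invr_gt0 // ler_norml.
  by move: (fg n) (gf n); rewrite -!(ler_nat R) !natrD => h1 h2; apply/andP; split; lra.
by near=> n; split; near: n; [exact: nbhs_infty_ger|exact: nbhs_infty_gt].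
Unshelve. all: by end_near. Qed.

Section path_space.
Context {A : countType} (a0 : A).

(** Measurable types are pointed, while the alphabet is only countable; any
    letter supplies the point. *)
Definition pointed_alphabet : pointedType :=
  HB.pack_for pointedType A (isPointed.Build A a0).

Definition path_space : measurableType _ :=
  g_sigma_algebraType (@path_cylinders pointed_alphabet).

Lemma measurable_letter (t : int) (a : A) :
  measurable ([set x : int -> A | x t = a] : set path_space).
Proof. by apply: sub_sigma_algebra; exists t, a. Qed.

Lemma measurable_path_shift :
  measurable_fun setT (@path_shift A : path_space -> path_space).
Proof.
apply: (@measurability _ _ path_space path_space _ _ (@path_cylinders pointed_alphabet)) => //.
move=> _ [_ [t [a ->]] <-]; rewrite setTI.
exact: (measurable_letter (t + 1) a).
Qed.

Lemma measurable_window (Q : set (seq A)) (a : int) (n : nat) :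
  measurable ([set x : int -> A | Q (mkseq (fun i : nat => x (a + i%:Z)) n)] : set path_space).
Proof.
elim: n Q => [|n IH] Q.
  have [Q0|Q0] := pselect (Q [::]).
    by rewrite (_ : [set x | _] = setT) //; apply/seteqP; split.
  by rewrite (_ : [set x | _] = set0) //; apply/seteqP; split.
rewrite (_ : [set x | _] = \bigcup_(b in [set: A])
  ([set x : int -> A | x (a + n%:Z) = b] `&`
   [set x : int -> A | [set v | Q (rcons v b)] (mkseq (fun i : nat => x (a + i%:Z)) n)])).
  apply: countable_bigcupT_measurable => [|b]; first exact: countableP.
  by apply: measurableI; [exact: measurable_letter|exact: IH].
apply/seteqP; split => x /=; first by rewrite mkseqS => h; exists (x (a + n%:Z)).
by case=> b _ [/= <-]; rewrite mkseqS.
Qed.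

Lemma measurable_block (Q : set (seq A)) (a b : int) :
  measurable ([set x : int -> A | Q (block x a b)] : set path_space).
Proof.
have [ab|ba] := leP a b.
  rewrite (_ : [set x | _] =
    [set x : int -> A | Q (mkseq (fun i : nat => x (a + i%:Z)) `|b - a|.+1)]).
    exact: measurable_window.
  by apply/seteqP; split => x /=; rewrite (@block_mkseq _ _ _ _ `|b - a|.+1) //; lia.
rewrite (_ : [set x | _] = [set x : int -> A | Q (mkseq (fun i : nat => x (a + i%:Z)) 0)]).
  exact: measurable_window.
by apply/seteqP; split => x /=; rewrite /block (@zrange_iota _ _ 0) //; right.
Qed.

End path_space.

Section frequencies.
Context {A : countType}.
Implicit Types (U : seq (seq A)) (x : int -> A).

Definition hits U x n := count (fun t => has (fun u => occ u x t.+1) U) (iota 0 n).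

Definition ends_in U : set (int -> A) :=
  [set x | has (fun u => block x (- (size u)%:Z + 1) 0 == u) U].

Lemma count_le_after (p q : pred nat) (k n : nat) :
  (forall t, (k <= t)%N -> p t -> q t) ->
  (count p (iota 0 n) <= count q (iota 0 n) + k)%N.
Proof.
move=> pq; have [nk|kn] := leqP n k.
  by rewrite (leq_trans (count_size _ _)) // size_iota (leq_trans nk) // leq_addl.
rewrite -(subnKC (ltnW kn)) iotaD !count_cat addnAC leq_add //.
  by rewrite (leq_trans (count_size _ _)) // size_iota leq_addl.
rewrite -!size_filter uniq_leq_size ?filter_uniq ?iota_uniq // => t.
rewrite !mem_filter mem_iota add0n => /andP[pt /andP[kt tn]].
by rewrite (pq _ kt pt) kt tn.
Qed.

Context {d : measure_display} {Omega : measurableType d} {R : realType}.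
Variables (P : probability Omega R) (X : int -> Omega -> A).
Hypotheses (HX : discrete_process X) (Hstat : stationary P X) (Herg : ergodic P X).

Let a0 : A := X 0 point.

Lemma measurable_sample_path :
  measurable_fun setT (sample_path X : Omega -> path_space a0).
Proof.
apply: (@measurability _ _ _ (path_space a0) _ _ (@path_cylinders (pointed_alphabet a0))) => //.
move=> _ [_ [t [a ->]] <-]; rewrite setTI.
exact: (HX t [set a]).
Qed.

Lemma measurable_path_event (B : set (int -> A)) :
  path_measurable B -> measurable [set o | B (sample_path X o)].
Proof.
move=> mB; rewrite -[X in measurable X]setTI.
by apply: measurable_sample_path.
Qed.

Lemma path_measurable_ends_in U : path_measurable (ends_in U).
Proof.
rewrite (_ : ends_in U = \bigcup_(u in [set: seq A]) [set x : int -> A |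
    [set v | v = u /\ u \in U] (block x (- (size u)%:Z + 1) 0)]).
  apply: (@countable_bigcupT_measurable _ (path_space a0)) => [|u].
    exact: countableP.
  exact: measurable_block.
apply/seteqP; split => x /=; first by move/hasP => [u uU /eqP ?]; exists u.
by case=> u _ [xu uU]; apply/hasP; exists u => //; apply/eqP.
Qed.

Lemma measurable_ends_in_event U : measurable [set o | ends_in U (sample_path X o)].
Proof. exact: measurable_path_event (path_measurable_ends_in U). Qed.

(** The ergodic theorem applied to the law of the process on path space.  For
    an event at time 0 the letters at negative times matter, whereas [hits]
    only sees letters at nonnegative times; the two counts agree after the
    length of the longest word. *)
Lemma hits_cvg_ae U :
  {ae P, forall o, (hits U (sample_path X o) n)%:R / n%:R @[n --> \oo] -->
    fine (P [set o | ends_in U (sample_path X o)])}.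
Proof.
pose law : probability (path_space a0) R :=
  distribution P (mfun_Sub (mem_set measurable_sample_path)).
have mU : measurable (ends_in U : set (path_space a0)) by exact: path_measurable_ends_in.
have [||N [mN N0 sN]] :=
  @visits_cvg_ae _ _ R law (@path_shift A) (@measurable_path_shift A a0) _ _ _ mU.
- by move=> B mB; exact: (Hstat mB).
- move=> B mB e; apply: (Herg mB) => x.
  by rewrite -[in X in _ <-> X]e.
exists [set o | N (sample_path X o)]; split => //.
  exact: measurable_path_event.
move=> o /= ho; apply: sN => /= h; apply: ho.
pose k := (\max_(u <- U) size u)%N.
have agree t : (k <= t)%N -> (iter t (@path_shift A) (sample_path X o) \in ends_in U) =
    has (fun u => occ u (sample_path X o) t.+1) U.
  move=> kt; rewrite /ends_in; apply/idP/idP; rewrite ?inE.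
    move/hasP => [u uU h2]; apply/hasP; exists u => //.
    by rewrite occ_iter_shift // ltnW // ltnS (leq_trans _ kt) // (leq_bigmax_seq _ uU).
  move/hasP => [u uU h2]; apply/hasP; exists u => //.
  rewrite -occ_iter_shift // ltnW // ltnS (leq_trans _ kt) // (leq_bigmax_seq _ uU) //.
apply: (@cvg_ratio_bounded_diff R _ _ k _ _ _ h) => n; apply: count_le_after => t kt.
  by rewrite agree.
by rewrite -agree.
Qed.

End frequencies.
(** * Partitions by a countable-valued variable *)

Section fibers.
Context {d : measure_display} {Omega : measurableType d} {R : realType}.
Variables (P : probability Omega R) (T : countType) (Y : Omega -> T).
Hypothesis mY : forall B : set T, measurable (Y @^-1` B).

Definition fiber (k : nat) : set Omega := [set o | pickle (Y o) = k].

Lemma measurable_fiber k : measurable (fiber k).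
Proof. exact: (mY [set y | pickle y = k]). Qed.

Lemma fiber_pickle y : fiber (pickle y) = Y @^-1` [set y].
Proof.
apply/seteqP; split => o /=; last by rewrite /fiber /= => ->.
by rewrite /fiber /= => /(pcan_inj pickleK).
Qed.

Lemma fiber_case k : (exists y, fiber k = Y @^-1` [set y]) \/ fiber k = set0.
Proof.
have [[y yk]|h] := pselect (exists y : T, pickle y = k).
  by left; exists y; rewrite -yk fiber_pickle.
by right; apply/seteqP; split => // o; rewrite /fiber /= => e; apply: h; exists (Y o).
Qed.

Lemma trivIset_fiber D : trivIset setT (fun k => D `&` fiber k).
Proof.
apply/trivIsetP => i j _ _ /eqP ij; apply/seteqP; split => // o [[_ oi] [_ oj]].
by apply: ij; rewrite -oi -oj.
Qed.

Lemma bigcup_fiber D : \bigcup_k (D `&` fiber k) = D.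
Proof.
by apply/seteqP; split => o; [case=> k _ []|exists (pickle (Y o))].
Qed.

Lemma measure_fibers D : measurable D ->
  P D = (\sum_(k <oo) P (D `&` fiber k))%E.
Proof.
move=> mD; rewrite -[in LHS](bigcup_fiber D); apply: measure_semi_bigcup.
- by move=> k; apply: measurableI => //; exact: measurable_fiber.
- exact: trivIset_fiber.
- by rewrite bigcup_fiber.
Qed.

(** For comparing next-letter distributions one letter at a time. *)
Lemma le_measure_fibers (D D' : set Omega) (c : R) : 0 <= c ->
  measurable D -> measurable D' ->
  (forall y, (P (D `&` Y @^-1` [set y]) <= c%:E * P (D' `&` Y @^-1` [set y]))%E) ->
  (P D <= c%:E * P D')%E.
Proof.
move=> c0 mD mD' h; rewrite (measure_fibers mD) (measure_fibers mD').
rewrite -nneseriesZl //.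
apply: lee_nneseries => // k _.
have [[y ->]|->] := fiber_case k; first exact: h.
by rewrite !setI0 measure0 mule0.
Qed.

(** A union bound over a countable family of events which is summable because
    the [y]-th event is controlled by the probability of the value [y]. *)
Lemma union_bound_fibers (F : T -> set Omega) (K : R) : 0 <= K ->
  (forall y, measurable (F y)) ->
  (forall y, (P (F y) <= K%:E * P (Y @^-1` [set y]))%E) ->
  (P (\bigcup_y F y) <= K%:E)%E.
Proof.
move=> K0 mF h.
pose G k := if unpickle k is Some y then (if pickle y == k then F y else set0) else set0.
have mG k : measurable (G k) by rewrite /G; case: unpickle => // y; case: eqP.
have -> : \bigcup_y F y = \bigcup_k G k.
  apply/seteqP; split => o [y _ oy].
    by exists (pickle y) => //; rewrite /G pickleK eqxx.
  by move: oy; rewrite /G; case: unpickle => // z; case: eqP => // _; exists z.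
apply: le_trans (measure_sigma_subadditive _ mG _ (@subset_refl _ _)) _.
  exact: bigcup_measurable.
apply: le_trans (_ : (\sum_(k <oo) K%:E * P (setT `&` fiber k) <= _)%E).
  apply: lee_nneseries => // k _; rewrite /G setTI.
  case e : unpickle => [y|]; last by rewrite measure0 mule_ge0.
  case: eqP => [yk|_]; last by rewrite measure0 mule_ge0.
  apply: le_trans (h y) _; rewrite -yk fiber_pickle.
  by apply: lee_wpmul2l.
rewrite nneseriesZl // -measure_fibers // probability_setT mule1 //.
Qed.

Lemma ge0_integral_fibers D (f : Omega -> \bar R) : measurable D ->
  measurable_fun D f -> (forall o, D o -> 0 <= f o)%E ->
  (\int[P]_(o in D) f o = \sum_(k <oo) \int[P]_(o in D `&` fiber k) f o)%E.
Proof.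
move=> mD mf f0; rewrite -[in LHS](bigcup_fiber D) ge0_integral_bigcup //.
- by move=> k; apply: measurableI => //; exact: measurable_fiber.
- by rewrite bigcup_fiber.
- by rewrite bigcup_fiber.
- exact: trivIset_fiber.
Qed.

End fibers.
(** * Word probabilities and memory words *)

Section words_probability.
Context {A : countType} {d : measure_display} {Omega : measurableType d} {R : realType}.
Variables (P : probability Omega R) (X : int -> Omega -> A).
Hypotheses (HX : discrete_process X) (Hstat : stationary P X).
Notation path := (sample_path X).

Definition word_event (u : seq A) : set Omega :=
  [set o | block (path o) (- (size u)%:Z + 1) 0 = u].

Lemma path_measurable_block_event (Q : set (seq A)) (a b : int) :
  path_measurable [set x : int -> A | Q (block x a b)].
Proof. exact: (@measurable_block A (X 0 point)). Qed.

Lemma measurable_past (Q : set (seq A)) s : measurable [set o | Q (past (path o) s)].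
Proof.
pose B := [set x : int -> A | Q (past x s)].
suff : path_measurable B by exact: (measurable_path_event HX).
rewrite (_ : B = [set x : int -> A | Q (block x 0 (s%:Z - 1))]).
  exact: path_measurable_block_event.
apply/seteqP; split => x; rewrite /B /= (@block_mkseq _ _ _ _ s) //; try lia;
  by rewrite (_ : past x s = mkseq (fun i : nat => x (0 + i%:Z)) s) //;
  apply: eq_mkseq => i; rewrite add0r.
Qed.

Lemma measurable_word_event u : measurable (word_event u).
Proof.
exact: (measurable_path_event HX (path_measurable_block_event [set u] _ _)).
Qed.

Lemma stationary_iter t (B : set (int -> A)) : path_measurable B ->
  P [set o | B (iter t (@path_shift A) (path o))] = P [set o | B (path o)].
Proof.
elim: t B => [//|t IH] B mB.
rewrite -(Hstat mB); rewrite -[RHS](IH [set x | B (path_shift x)]).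
  by congr (P _); apply/seteqP; split => o /=; rewrite -iterS iterSr.
pose a0 := X 0 point.
have := @measurable_path_shift A a0 measurableT B mB.
by rewrite setTI.
Qed.

Lemma occ_prob u s : (size u <= s)%N ->
  P [set o | occ u (path o) s] = P (word_event u).
Proof.
case: s => [|t] us.
  case: u us => // _; congr (P _); apply/seteqP; split => o //=.
rewrite -(@stationary_iter t [set x | block x (- (size u)%:Z + 1) 0 = u]); last first.
  exact: (path_measurable_block_event [set u]).
by congr (P _); apply/seteqP; split => o /=; rewrite occ_iter_shift // => /eqP.
Qed.

Lemma past_eq_occ (x : int -> A) v : (past x (size v) = v) <-> occ v x (size v).
Proof.
split=> [e|]; first by rewrite /occ e suffix_refl.
by rewrite /occ suffixE size_past subnn drop0 => /eqP.
Qed.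

Lemma past_prob v : P [set o | past (path o) (size v) = v] = P (word_event v).
Proof.
rewrite -(@occ_prob v (size v)) //; congr (P _).
by apply/seteqP; split => o /=; rewrite past_eq_occ.
Qed.

Lemma word_event_rcons v a :
  P (word_event (rcons v a)) = P (word_event v `&` [set o | X 1 o = a]).
Proof.
pose B : set (int -> A) := [set x | block x (- (size (rcons v a))%:Z + 1) 0 = rcons v a].
rewrite -(@stationary_iter 1%N B); last exact: (path_measurable_block_event [set rcons v a]).
congr (P _).
have e o : block (iter 1 (@path_shift A) (path o)) (- (size (rcons v a))%:Z + 1) 0 =
    rcons (block (path o) (- (size v)%:Z + 1) 0) (X 1 o).
  rewrite size_rcons (@block_mkseq _ _ _ _ (size v).+1); last lia.
  rewrite (@block_mkseq _ _ _ _ (size v)); last lia.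
  rewrite mkseqS; congr rcons; last by rewrite /= /path_shift /sample_path; congr X; lia.
  by apply: eq_mkseq => i; rewrite /= /path_shift; congr (path o _); lia.
apply/seteqP; split => o; rewrite /B /= e /word_event /=.
  by move/eqP; rewrite eqseq_rcons => /andP[/eqP ? /eqP ?].
by case=> -> ->.
Qed.

Lemma word_probE u : P (word_event u) = (word_prob P X u)%:E.
Proof. by rewrite fineK // fin_num_measure //; exact: measurable_word_event. Qed.

Lemma word_prob_ge0 u : 0 <= word_prob P X u.
Proof. by rewrite fine_ge0. Qed.

Lemma next_probE a u : next_prob P X a u = word_prob P X (rcons u a) / word_prob P X u.
Proof.
by rewrite /next_prob /cond_prob setIC -word_event_rcons.
Qed.

End words_probability.

Section memory.
Context {A : countType} {d : measure_display} {Omega : measurableType d} {R : realType}.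
Variables (P : probability Omega R) (X : int -> Omega -> A).

Definition memory_word (w : seq A) : Prop :=
  forall (a : A) (z : seq A), (0 < size z)%N ->
  0 < word_prob P X (z ++ rcons w a) ->
  next_prob P X a w = next_prob P X a (z ++ w).

Lemma memory_propertyE (x : int -> A) K :
  memory_property P X x K <-> memory_word (block x (- K%:Z + 1) 0).
Proof.
rewrite /memory_property /=; split=> [h a z z0|h i a z i0 sz].
  by rewrite -cats1 => pz; exact: (h (size z)).
by rewrite cats1; apply: h; rewrite sz.
Qed.

Hypotheses (HX : discrete_process X) (Hstat : stationary P X).
Notation path := (sample_path X).
Notation p := (word_prob P X).

Lemma word_prob_suffix w v : suffix w v -> p v <= p w.
Proof.
move=> wv; have wv' := size_suffix wv.
rewrite -lee_fin -!(word_probE P HX) -(occ_prob Hstat (leqnn (size v))).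
rewrite -(occ_prob Hstat wv'); apply: le_measure; rewrite ?inE.
- exact: (measurable_past HX [set u | suffix v u]).
- exact: (measurable_past HX [set u | suffix w u]).
- by move=> o /=; exact: suffix_trans.
Qed.

Lemma word_prob_rcons_split v a :
  fine (P (word_event X v `&` [set o | X 1 o <> a])) = p v - p (rcons v a).
Proof.
have mv := measurable_word_event HX v.
have m1 := HX 1 [set a].
have m2 : measurable [set o | X 1 o <> a] := HX 1 (~` [set a]).
pose E := word_event X v `&` [set o | X 1 o <> a].
have EE : P E = (fine (P E))%:E.
  by rewrite fineK // fin_num_measure //; exact: measurableI.
apply/eqP; rewrite -/E eq_sym subr_eq addrC -eqe EFinD -EE.
rewrite -!(word_probE P HX) (word_event_rcons Hstat); apply/eqP.
have split_v : word_event X v = (word_event X v `&` [set o | X 1 o = a]) `|`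
    (word_event X v `&` [set o | X 1 o <> a]).
  apply/seteqP; split=> o /=; last by case=> -[].
  by move=> h; have [] := pselect (X 1 o = a); [left|right].
rewrite [in LHS]split_v; apply: measureU; [exact: measurableI|exact: measurableI|].
by apply/seteqP; split => // o /= [[_ h] [_]] /(_ h).
Qed.

(** The defining property of memory words says nothing about letters that
    cannot follow the extension [v].  For these the identity holds because
    both next-letter laws have total mass 1: after scaling, the law after [v]
    is dominated letter by letter by the law after [w], so that the two
    agree. *)
Lemma memory_word_next w v a : memory_word w -> suffix w v ->
  p (rcons v a) = next_prob P X a w * p v.
Proof.
move=> mem wv; rewrite next_probE //.
have rc u b : p (rcons u b) <= p u.
  by rewrite -subr_ge0 -word_prob_rcons_split fine_ge0.
have [pw0|pw] := eqVneq (p w) 0.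
  rewrite pw0 invr0 mulr0 mul0r; apply/eqP; rewrite eq_le word_prob_ge0 andbT.
  by rewrite (le_trans (rc _ _)) // (le_trans (word_prob_suffix wv)) // pw0.
have {}pw : 0 < p w by rewrite lt0r pw word_prob_ge0.
(* An equality when [rcons v b] is possible, and trivial otherwise. *)
have dominated b : p (rcons v b) <= p v / p w * p (rcons w b).
  have [->|pvb] := eqVneq (p (rcons v b)) 0.
    by rewrite !mulr_ge0 ?invr_ge0 ?word_prob_ge0.
  have {}pvb : 0 < p (rcons v b) by rewrite lt0r pvb word_prob_ge0.
  have pv : 0 < p v := lt_le_trans pvb (rc v b).
  have [z e] := suffixP wv; have [z0|z0] := posnP (size z).
    by rewrite e (size0nil z0) cat0s mulfV ?mul1r // gt_eqF.
  have := mem b z z0; rewrite -rcons_cat -e => /(_ pvb).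
  rewrite !next_probE // => /(congr1 (fun r => p v * r)).
  rewrite (mulrC (p v) (_ / p v)) divfK ?gt_eqF // => <-.
  by rewrite mulrAC mulrA.
apply/eqP; rewrite eq_le; apply/andP; split.
  by rewrite (le_trans (dominated a)) // mulrAC [p v * _]mulrC mulrAC.
have m2 : measurable [set o | X 1 o <> a] := HX 1 (~` [set a]).
(* The bounds at the letters other than [a] sum to a bound on the complement of [a]. *)
have := @le_measure_fibers _ _ R P A (X 1) (HX 1)
  (word_event X v `&` [set o | X 1 o <> a]) (word_event X w `&` [set o | X 1 o <> a])
  (p v / p w).
rewrite divr_ge0 ?word_prob_ge0 // => /(_ isT) H.
have {H} : (P (word_event X v `&` [set o | X 1 o <> a]) <=
    (p v / p w)%:E * P (word_event X w `&` [set o | X 1 o <> a]))%E.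
  apply: H; [exact: measurableI (measurable_word_event HX v) m2|
             exact: measurableI (measurable_word_event HX w) m2|move=> b].
  have [->|ba] := eqVneq b a.
    rewrite (_ : _ `&` _ = set0) ?measure0 ?mule_ge0 ?lee_fin ?divr_ge0 ?word_prob_ge0 //.
    by apply/seteqP; split => // o [[_ /= +]].
  have e u : word_event X u `&` [set o | X 1 o <> a] `&` X 1 @^-1` [set b] =
      word_event X u `&` [set o | X 1 o = b].
    apply/seteqP; split => o /=; first by case=> -[].
    by move=> [h1 h2]; split => //; split => //; rewrite h2; apply/eqP.
  rewrite !e -!(word_event_rcons Hstat) !(word_probE P HX) -EFinM lee_fin.
  exact: dominated.
rewrite -[X in (X <= _)%E]fineK; last first.
  by rewrite fin_num_measure //; exact: measurableI (measurable_word_event HX v) m2.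
rewrite -[X in (_ <= _ * X)%E]fineK; last first.
  by rewrite fin_num_measure //; exact: measurableI (measurable_word_event HX w) m2.
rewrite !word_prob_rcons_split -EFinM lee_fin mulrBr divfK ?gt_eqF //.
by rewrite lerD2l lerN2; apply: le_trans; rewrite mulrAC [p (rcons w a) * _]mulrC mulrAC.
Qed.

End memory.
(** * Functionals of the past and the next letter *)

Section adapted.
Context {A : countType} {d : measure_display} {Omega : measurableType d} {R : realType}.
Variables (P : probability Omega R) (X : int -> Omega -> A).
Hypotheses (HX : discrete_process X).
Notation path := (sample_path X).

Definition adapted (T : Type) (s : nat) (h : (int -> A) -> T) : Prop :=
  forall x y, past x s = past y s -> h x = h y.

Lemma take_past x s t : (t <= s)%N -> take t (past x s) = past x t :> seq A.
Proof. by move=> ts; rewrite /past /mkseq -map_take take_iota (minn_idPl ts). Qed.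

Lemma adapted_past (T : Type) s t (h : (int -> A) -> T) :
  (t <= s)%N -> adapted t h -> adapted s h.
Proof. by move=> ts ah x y xy; apply: ah; rewrite -!(take_past _ ts) xy. Qed.

Lemma measurable_adapted s (h : (int -> A) -> R) : adapted s h ->
  measurable_fun setT (fun o => h (path o)).
Proof.
move=> ah _ B mB; rewrite setTI.
rewrite (_ : _ @^-1` B = [set o | [set v | exists o', past (path o') s = v /\ B (h (path o'))]
   (past (path o) s)]); first exact: measurable_past.
apply/seteqP; split => o /=; first by exists o.
by case=> z [e]; rewrite (ah _ _ e).
Qed.

Lemma adapted_occ u t s : (t <= s)%N -> adapted s (fun x => occ u x t).
Proof. by move=> ts; apply: (adapted_past ts) => x y e; rewrite /occ e. Qed.

Lemma adapted_occs u t s : (t <= s.+1)%N -> adapted s (fun x => occs u x t).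
Proof.
move=> ts x y e; apply: eq_in_count => i; rewrite mem_iota => /andP[_ it].
by apply: (@adapted_occ u i s) => //; rewrite -ltnS; apply: leq_trans ts.
Qed.

(** The independence statement that replaces conditional expectations: on the
    event that [u] ends the past, the next letter is independent of the past.
    It is checked on each atom of the past, where [h] is constant. *)
Lemma integral_next_letter s (h : (int -> A) -> R) (u : seq A) (B : set A) (c : R) :
  adapted s h -> (forall x, 0 <= h x) -> 0 <= c ->
  (forall v, size v = s -> suffix u v ->
    P ([set o | past (path o) s = v] `&` [set o | B (X s%:Z o)]) =
    (c%:E * P [set o | past (path o) s = v])%E) ->
  (\int[P]_(o in [set o | occ u (path o) s] `&` [set o | B (X s%:Z o)]) (h (path o))%:E =
   c%:E * \int[P]_(o in [set o | occ u (path o) s]) (h (path o))%:E)%E.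
Proof.
move=> ah h0 c0 hc.
have mh : measurable_fun setT (fun o => (h (path o))%:E).
  by apply/measurable_EFinP; exact: measurable_adapted ah.
have mO : measurable [set o | occ u (path o) s].
  exact: (measurable_past HX [set v | suffix u v]).
have mB : measurable [set o | B (X s%:Z o)] := HX s%:Z B.
have mY (Q : set (seq A)) : measurable ((fun o => past (path o) s) @^-1` Q).
  exact: measurable_past.
rewrite (@ge0_integral_fibers _ _ _ P _ _ mY) //; last 3 first.
- exact: measurableI.
- exact: measurable_funTS.
- by move=> o _; rewrite lee_fin.
rewrite (@ge0_integral_fibers _ _ _ P _ _ mY) //; last 2 first.
- exact: measurable_funTS.
- by move=> o _; rewrite lee_fin.
rewrite -nneseriesZl //; last by move=> k _; apply: integral_ge0 => o _; rewrite lee_fin.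
apply: eq_eseriesr => k _.
have [[v ->]|->] := fiber_case (fun o => past (path o) s) k; last first.
  by rewrite !setI0 !integral_set0 mule0.
have [uv|uv] := boolP (suffix u v); last first.
  rewrite (_ : _ `&` _ `&` _ = set0).
    rewrite (_ : _ `&` _ = set0) ?integral_set0 ?mule0 //.
    by apply/seteqP; split => // o /= [h1 e]; move: h1; rewrite /occ e (negbTE uv).
  by apply/seteqP; split => // o /= [[h1 _] e]; move: h1; rewrite /occ e (negbTE uv).
have [[z0 hz0]|no] := pselect (exists o, past (path o) s = v); last first.
  rewrite (_ : _ @^-1` [set v] = set0) ?setI0 ?integral_set0 ?mule0 //.
  by apply/seteqP; split => // o /= e; apply: no; exists o.
have sv : size v = s by rewrite -hz0 size_past.
have int_fiber (E : set Omega) : measurable E -> E `<=` [set o | past (path o) s = v] ->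
    (\int[P]_(o in E) (h (path o))%:E = (h (path z0))%:E * P E)%E.
  move=> mE Ev; rewrite -integral_cst //; apply: eq_integral => o; rewrite inE => /Ev e.
  by congr (_%:E); apply: ah; rewrite hz0.
rewrite int_fiber; last 2 first.
- by apply: measurableI => //; exact: measurableI.
- by move=> o [].
rewrite int_fiber; last 2 first.
- by apply: measurableI => //.
- by move=> o [].
rewrite muleCA; congr (_ * _)%E.
have := hc v sv uv; rewrite (_ : _ `&` _ `&` _ =
  [set o | past (path o) s = v] `&` [set o | B (X s%:Z o)]).
  move=> ->; congr (_ * P _)%E; apply/seteqP; split => o /=; last by case.
  by move=> e; split => //; rewrite /occ e.
apply/seteqP; split => o /=; first by move=> [[_ b] e].
by move=> [e b]; split => //; split => //; rewrite /occ e.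
Qed.

End adapted.
(** * An exponential supermartingale for letter counts *)

Lemma occsS (A : countType) (v : seq A) (x : int -> A) s :
  occs v x s.+1 = (occs v x s + occ v x s)%N.
Proof. by rewrite /occs -addn1 iotaD count_cat /= addn0 add0n. Qed.

(** From [1 - t <= expR (- t)], since [(1 - t) * (1 + t + 2 * t ^+ 2)] is
    [1 + t ^+ 2 * (1 - 2 * t)]. *)
Lemma expR_le_quadratic (R : realType) (t : R) : t <= 1 / 2 -> expR t <= 1 + t + 2 * t ^+ 2.
Proof.
move=> t2; have := expR_ge1Dx (- t); rewrite expRN => h.
have e0 : 0 < expR t := expR_gt0 t.
have {}h : (1 - t) * expR t <= 1 by rewrite -ler_pdivlMr // div1r.
have h2 : 1 <= (1 - t) * (1 + t + 2 * t ^+ 2).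
  have : 0 <= t ^+ 2 * (1 - 2 * t) by rewrite mulr_ge0 ?sqr_ge0 //; lra.
  by rewrite !expr2; nra.
by have := le_trans h h2; rewrite ler_pM2l //; lra.
Qed.

(** The first-order terms cancel because [1 - p] and [- p] are the values of a
    centred Bernoulli variable. *)
Lemma bernoulli_mgf_le (R : realType) (p lam : R) : 0 <= p <= 1 -> `|lam| <= 1 / 2 ->
  p * expR (lam * (1 - p)) + (1 - p) * expR (- (lam * p)) <= expR (2 * lam ^+ 2).
Proof.
move=> /andP[p0 p1]; rewrite ler_norml => /andP[l1 l2].
apply: le_trans (expR_ge1Dx _).
have h1 : expR (lam * (1 - p)) <= 1 + lam * (1 - p) + 2 * (lam * (1 - p)) ^+ 2.
  by apply: expR_le_quadratic; nra.
have h2 : expR (- (lam * p)) <= 1 + - (lam * p) + 2 * (- (lam * p)) ^+ 2.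
  by apply: expR_le_quadratic; nra.
have q0 : 0 <= 1 - p by lra.
apply: le_trans (lerD (ler_wpM2l p0 h1) (ler_wpM2l q0 h2)) _.
have : 0 <= lam ^+ 2 * (1 - p * (1 - p)).
  by rewrite mulr_ge0 ?sqr_ge0 //; nra.
rewrite !expr2; nra.
Qed.

Section ge0_integral_split.
Context {d : measure_display} {T : measurableType d} {R : realType}.
Variable P : {measure set T -> \bar R}.

Lemma ge0_integral_split (D E : set T) (f : T -> R) : measurable D -> measurable E ->
  measurable_fun setT f -> (forall x, 0 <= f x) ->
  (\int[P]_(x in D) (f x)%:E =
   \int[P]_(x in D `&` E) (f x)%:E + \int[P]_(x in D `&` ~` E) (f x)%:E)%E.
Proof.
move=> mD mE mf f0; rewrite -ge0_integral_setU //.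
- by rewrite -setIUr setUCr setIT.
- exact: measurableI.
- by apply: measurableI => //; exact: measurableC.
- by apply: measurable_funTS; apply/measurable_EFinP.
- by move=> x _; rewrite lee_fin.
- by apply/disj_setPS => x [[_ Ex] [_ nEx]].
Qed.

End ge0_integral_split.

Section tilted_counts.
Context {A : countType} {d : measure_display} {Omega : measurableType d} {R : realType}.
Variables (P : probability Omega R) (X : int -> Omega -> A).
Hypotheses (HX : discrete_process X) (Hstat : stationary P X).
Notation path := (sample_path X).
Variables (w u : seq A) (a : A).
Hypotheses (mem : memory_word P X w) (wu : suffix w u).
Variable lam : R.
Hypothesis lam_small : `|lam| <= 1 / 2.

Let p : R := next_prob P X a w.

Lemma next_prob01 : 0 <= p <= 1.
Proof.
rewrite /p next_probE // divr_ge0 ?word_prob_ge0 //=.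
have [->|pw] := eqVneq (word_prob P X w) 0; first by rewrite invr0 mulr0.
rewrite ler_pdivrMr ?lt0r ?pw ?word_prob_ge0 // mul1r.
by rewrite -subr_ge0 -(word_prob_rcons_split HX Hstat) fine_ge0.
Qed.

Lemma next_letter_prob s v : size v = s -> suffix u v ->
  P ([set o | past (path o) s = v] `&` [set o | [set a] (X s%:Z o)]) =
  (p%:E * P [set o | past (path o) s = v])%E.
Proof.
move=> sv uv; rewrite (_ : _ `&` _ = [set o | past (path o) (size (rcons v a)) = rcons v a]).
  rewrite -sv !(past_prob Hstat) !word_probE // -EFinM.
  by rewrite (memory_word_next HX Hstat _ mem (suffix_trans wu uv)).
rewrite size_rcons sv; apply/seteqP; split => o /=.
  by rewrite pastS => -[-> <-].
by move=> /eqP; rewrite pastS eqseq_rcons => /andP[/eqP ? /eqP ?].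
Qed.

Lemma next_letterC_prob s v : size v = s -> suffix u v ->
  P ([set o | past (path o) s = v] `&` [set o | (~` [set a]) (X s%:Z o)]) =
  ((1 - p)%:E * P [set o | past (path o) s = v])%E.
Proof.
move=> sv uv; have := next_letter_prob sv uv.
set E := [set o | past _ s = v]; set B := [set o | [set a] _] => h.
have mE : measurable E := measurable_past HX [set v] s.
have mB : measurable B := HX s%:Z [set a].
have : P E = (P (E `&` B) + P (E `&` ~` B))%E.
  rewrite -measureU; first by rewrite -setIUr setUCr setIT.
  - exact: measurableI.
  - by apply: measurableI => //; exact: measurableC.
  - by apply/seteqP; split => // o [[_ Bo] [_ nBo]].
rewrite h => e.
have : P (E `&` ~` B) = (P E - p%:E * P E)%E.
  rewrite [X in (X - _)%E]e addeAC subee ?add0e //.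
  by rewrite fin_numM // fin_num_measure.
move=> ->; rewrite -(fineK (fin_num_measure P E mE)) -!EFinM -EFinB.
by rewrite mulrBl mul1r.
Qed.

(** At position [s] the occurrences of [u] up to [s - 1] have been followed by
    a letter, which is why [rcons u a] is counted one position further. *)
Definition tilt s (x : int -> A) : R :=
  expR (lam * ((occs (rcons u a) x s.+1)%:R - p * (occs u x s)%:R)
        - 2 * lam ^+ 2 * (occs u x s)%:R).

Lemma tilt_ge0 s x : 0 <= tilt s x. Proof. exact: expR_ge0. Qed.

Lemma adapted_tilt s : adapted s (tilt s).
Proof.
move=> x y e; rewrite /tilt (@adapted_occs _ (rcons u a) s.+1 s _ _ _ e) //.
by rewrite (@adapted_occs _ u s s _ _ _ e).
Qed.

Let up : R := expR (lam * (1 - p) - 2 * lam ^+ 2).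
Let dn : R := expR (- (lam * p) - 2 * lam ^+ 2).

Lemma tilt_step s x : tilt s.+1 x =
  tilt s x * (if occ u x s then (if x s%:Z == a then up else dn) else 1).
Proof.
rewrite /tilt /up /dn (occsS u) (occsS (rcons u a)) occ_rcons.
case: (occ u x s) => /=; last by rewrite !addn0 mulr1.
case: (x _ == a) => /=; rewrite -expRD ?addn0 !natrD; congr expR; lra.
Qed.

Lemma up_dn_le1 : p * up + (1 - p) * dn <= 1.
Proof.
have := bernoulli_mgf_le next_prob01 lam_small.
rewrite -(ler_pM2r (expR_gt0 (- (2 * lam ^+ 2)))) mulrDl -[p * _ * _]mulrA.
by rewrite -[(1 - p) * _ * _]mulrA -!expRD subrr expR0.
Qed.

Lemma up_le2 : up <= 2.
Proof.
have /andP[p0 p1] := next_prob01.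
move: lam_small; rewrite ler_norml => /andP[l1 l2].
have h : lam * (1 - p) - 2 * lam ^+ 2 <= 1 / 2.
  by have := sqr_ge0 lam; nra.
have h2 : lam * (1 - p) <= 1 / 2 by nra.
have h3 : - (1 / 2) <= lam * (1 - p) by nra.
apply: le_trans (_ : expR (lam * (1 - p)) <= _).
  by rewrite ler_expR; have := sqr_ge0 lam; lra.
by apply: le_trans (expR_le_quadratic h2) _; rewrite expr2; nra.
Qed.

Lemma measurable_occ_event v s : measurable [set o | occ v (path o) s].
Proof. exact: (measurable_past HX [set z | suffix v z]). Qed.

(** The supermartingale property, tested against nonnegative functionals of
    the past: between two positions [tilt] changes only after an occurrence of
    [u], by the factor [up] with probability [p] and [dn] with probability
    [1 - p]. *)
Lemma integral_tilt_next s (h : (int -> A) -> R) : adapted s h -> (forall x, 0 <= h x) ->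
  (\int[P]_o (tilt s.+1 (path o) * h (path o))%:E <=
   \int[P]_o (tilt s (path o) * h (path o))%:E)%E.
Proof.
move=> ah h0.
pose f x := tilt s x * h x.
have f0 x : 0 <= f x by rewrite mulr_ge0 ?tilt_ge0.
have af : adapted s f by move=> x y e; rewrite /f (adapted_tilt e) (ah _ _ e).
have mf : measurable_fun setT (fun o => f (path o)) by exact: measurable_adapted af.
have mg : measurable_fun setT (fun o => tilt s.+1 (path o) * h (path o)).
  apply: (measurable_adapted HX (s := s.+1) (h := fun x => tilt s.+1 x * h x)) => x y e.
  by rewrite (adapted_tilt e) (adapted_past (leqnSn s) ah e).
have g0 o : 0 <= tilt s.+1 (path o) * h (path o) by rewrite mulr_ge0 ?tilt_ge0.
set O := [set o | occ u (path o) s]; set B := [set o | [set a] (X s%:Z o)].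
have mO : measurable O by exact: measurable_occ_event.
have mB : measurable B := HX s%:Z [set a].
have /andP[p0 p1] := next_prob01.
have int_part (E : set Omega) (c : R) : measurable E -> 0 <= c ->
    (forall o, E o -> tilt s.+1 (path o) * h (path o) = c * f (path o)) ->
    (\int[P]_(o in E) (tilt s.+1 (path o) * h (path o))%:E =
     c%:E * \int[P]_(o in E) (f (path o))%:E)%E.
  move=> mE c0 ec; rewrite -ge0_integralZl_EFin //.
  - by apply: eq_integral => o; rewrite inE => /ec ->; rewrite EFinM.
  - by move=> o _; rewrite lee_fin.
  - by apply: measurable_funTS; apply/measurable_EFinP.
rewrite (ge0_integral_split P measurableT mO mg g0) !setTI.
rewrite (ge0_integral_split P mO mB mg g0).
rewrite (ge0_integral_split P measurableT mO mf (fun o => f0 (path o))) !setTI.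
rewrite (int_part (O `&` B) up) ?expR_ge0 //; last 2 first.
- exact: measurableI.
- by move=> o [oO /= oB]; rewrite tilt_step oO {2}/sample_path oB eqxx mulrAC mulrC.
rewrite (int_part (O `&` ~` B) dn) ?expR_ge0 //; last 2 first.
- by apply: measurableI => //; exact: measurableC.
- by move=> o [oO /= /eqP/negbTE oB]; rewrite tilt_step oO {2}/sample_path oB mulrAC mulrC.
rewrite (int_part (~` O) 1) //; last 2 first.
- exact: measurableC.
- by move=> o /= /negP/negbTE oO; rewrite tilt_step oO mulr1 mul1r.
rewrite mul1e leeD2r //.
rewrite (integral_next_letter HX af f0 p0 (fun v sv uv => next_letter_prob sv uv)).
rewrite (integral_next_letter HX af f0 _ (fun v sv uv => next_letterC_prob sv uv)); last by lra.
have up0 : 0 <= up * p by rewrite mulr_ge0 // expR_ge0.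
have dn0 : 0 <= dn * (1 - p) by rewrite mulr_ge0 ?expR_ge0 // subr_ge0.
rewrite !muleA -!EFinM -ge0_muleDl ?lee_fin //.
rewrite -[X in (_ <= X)%E]mul1e; apply: lee_wpmul2r.
  by apply: integral_ge0 => o _; rewrite lee_fin.
by rewrite lee_fin mulrC [dn * _]mulrC; exact: up_dn_le1.
Qed.

Lemma tilt_before_occ s x : ~~ has (occ u x) (iota 0 s) -> tilt s x = 1.
Proof.
move=> no; rewrite /tilt.
have -> : occs u x s = 0%N by apply/eqP; rewrite eqn0Ngt -has_count.
have -> : occs (rcons u a) x s.+1 = 0%N.
  apply/eqP; rewrite eqn0Ngt -has_count; apply/hasPn => -[|t].
    by rewrite occ_small // size_rcons.
  rewrite mem_iota add0n ltnS => /= ts; rewrite occ_rcons negb_and.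
  by move/hasPn: no => /(_ t) -> //; rewrite mem_iota add0n.
by rewrite mulr0 subr0 mulr0 mulr0 subr0 expR0.
Qed.

(** Before the first occurrence of [u] the functional [tilt] equals 1, so the
    supermartingale may be started at that occurrence.  Its expectation on the
    event that [u] has been seen is then at most the sum of the probabilities
    that [u] occurs at one of the positions, which is proportional to the
    probability of [u]. *)
Lemma integral_tilt_seen s :
  (\int[P]_o (tilt s (path o) * (has (occ u (path o)) (iota 0 s.+1))%:R)%:E <=
   (s.+1%:R * word_prob P X u)%:E)%E.
Proof.
pose seen s x : R := (has (occ u x) (iota 0 s.+1))%:R.
have seen_ge0 t x : 0 <= seen t x by [].
have aseen t : adapted t (seen t).
  move=> x y e; rewrite /seen; congr ((nat_of_bool _)%:R); apply: eq_in_has => i.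
  by rewrite mem_iota add0n ltnS => /andP[_ it]; exact: (adapted_occ _ it e).
have atilt t : adapted t.+1 (fun x => tilt t.+1 x * seen t x).
  by move=> x y e; rewrite (adapted_tilt e) (adapted_past (leqnSn t) (@aseen t) e).
have int_occ t : (\int[P]_o ((occ u (path o) t)%:R)%:E <= (word_prob P X u)%:E)%E.
  rewrite (_ : (\int[P]_o _ = P [set o | occ u (path o) t])%E).
    have [ut|ut] := leqP (size u) t; first by rewrite occ_prob // word_probE.
    rewrite (_ : [set o | _] = set0) ?measure0 ?lee_fin ?word_prob_ge0 //.
    by apply/seteqP; split => // o; rewrite /= occ_small.
  rewrite -[X in P X]setTI setIC -integral_indic //; last exact: measurable_occ_event.
  apply: eq_integral => o _; rewrite indicE; congr (_%:R%:E).
  by apply/esym; congr nat_of_bool; apply/idP/idP; rewrite inE.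
elim: s => [|s IH].
  rewrite mul1r; apply: le_trans (int_occ 0%N).
  rewrite le_eqVlt; apply/orP; left; apply/eqP; apply: eq_integral => o _.
  by rewrite tilt_before_occ // mul1r /= orbF.
apply: (@le_trans _ _ (\int[P]_o ((tilt s.+1 (path o) * seen s (path o))%:E +
    ((occ u (path o) s.+1)%:R)%:E))%E).
  apply: ge0_le_integral => //.
  - by move=> o _; rewrite lee_fin mulr_ge0 ?tilt_ge0.
  - apply/measurable_EFinP; apply: (measurable_adapted HX (s := s.+1)
      (h := fun x => tilt s.+1 x * seen s.+1 x)) => x y e.
    by rewrite (adapted_tilt e) (aseen _ _ _ e).
  - apply/measurable_EFinP; apply: measurable_funD.
      exact: (measurable_adapted HX (atilt s)).
    apply: (measurable_adapted HX (s := s.+1) (h := fun x => (occ u x s.+1)%:R)) => x y e.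
    by rewrite (adapted_occ _ (leqnn s.+1) e).
  - move=> o _; rewrite -EFinD lee_fin /seen -(addn1 s.+1) iotaD has_cat.
    have [so|/tilt_before_occ ->] /= := boolP (has _ (iota 0 s.+1)).
      by rewrite mulr1 lerDl.
    by rewrite !add0n orbF mulr0 add0r mul1r.
rewrite ge0_integralD //; last 3 first.
- by move=> o _; rewrite lee_fin mulr_ge0 ?tilt_ge0.
- by apply/measurable_EFinP; exact: (measurable_adapted HX (atilt s)).
- apply/measurable_EFinP.
  apply: (measurable_adapted HX (s := s.+1) (h := fun x => (occ u x s.+1)%:R)) => x y e.
  by rewrite (adapted_occ _ (leqnn s.+1) e).
rewrite -natr1 mulrDl mul1r EFinD; apply: leeD (int_occ _).
exact: le_trans (integral_tilt_next (@aseen s) (seen_ge0 s)) IH.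
Qed.

(** The weight [occs (rcons u a)] brings in the probability of [rcons u a]: it
    grows only when [a] follows [u], which costs a factor [p], and on this
    event [integral_tilt_seen] applies.  The factor 2 bounds [up]. *)
Lemma integral_tilt_occs s :
  (\int[P]_o (tilt s (path o) * (occs (rcons u a) (path o) s.+1)%:R)%:E <=
   (2 * s%:R ^+ 2 * word_prob P X (rcons u a))%:E)%E.
Proof.
pose cnt s x : R := (occs (rcons u a) x s.+1)%:R.
have cnt_ge0 t x : 0 <= cnt t x by [].
have acnt t : adapted t (cnt t).
  by move=> x y e; rewrite /cnt (adapted_occs _ (leqnn t.+1) e).
have pua : word_prob P X (rcons u a) = p * word_prob P X u.
  exact: memory_word_next.
have /andP[p0 p1] := next_prob01.
elim: s => [|s IH].
  rewrite (_ : (\int[P]_o _ = 0)%E) ?lee_fin ?mulr_ge0 ?word_prob_ge0 //.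
  apply: integral0_eq => o _; rewrite /occs /= occ_small ?mulr0 //.
  by rewrite size_rcons.
set O := [set o | occ u (path o) s]; set B := [set o | [set a] (X s%:Z o)].
have mO : measurable O by exact: measurable_occ_event.
have mB : measurable B := HX s%:Z [set a].
have mt : measurable_fun setT (fun o => tilt s.+1 (path o)).
  exact: (measurable_adapted HX (@adapted_tilt s.+1)).
have mOB : measurable (O `&` B) by exact: measurableI.
have mi : measurable_fun setT (fun o => tilt s.+1 (path o) * \1_(O `&` B) o).
  by apply: measurable_funM => //; exact: measurable_indic.
have mc : measurable_fun setT (fun o => tilt s.+1 (path o) * cnt s (path o)).
  apply: measurable_funM => //; exact: (measurable_adapted HX (@acnt s)).
rewrite (_ : (\int[P]_o _ = \int[P]_o ((tilt s.+1 (path o) * cnt s (path o))%:E +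
    (tilt s.+1 (path o) * \1_(O `&` B) o)%:E))%E); last first.
  apply: eq_integral => o _; rewrite -EFinD -mulrDr /cnt (occsS _ _ s.+1) natrD.
  congr (_ * (_ + _))%:E.
  rewrite occ_rcons indicE; congr (nat_of_bool _)%:R.
  apply/idP/idP; rewrite ?inE; first by move=> /andP[? /eqP ?].
  by move=> [? /= /eqP ?]; apply/andP.
rewrite ge0_integralD //; last 4 first.
- by move=> o _; rewrite lee_fin mulr_ge0 ?tilt_ge0.
- exact/measurable_EFinP.
- by move=> o _; rewrite lee_fin mulr_ge0 ?tilt_ge0 // indicE.
- exact/measurable_EFinP.
have step : (\int[P]_o (tilt s.+1 (path o) * \1_(O `&` B) o)%:E <=
    (2 * s.+1%:R * word_prob P X (rcons u a))%:E)%E.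
  rewrite (_ : (\int[P]_o _ = \int[P]_(o in O `&` B) (up * tilt s (path o))%:E)%E); last first.
    rewrite [RHS]integral_mkcond; apply: eq_integral => o _.
    rewrite patchE indicE; case: ifPn; rewrite ?inE; last by rewrite mulr0.
    move=> [/= oO oB]; rewrite mulr1 tilt_step oO {2}/sample_path oB eqxx.
    by rewrite mulrC.
  under eq_integral do rewrite EFinM.
  have mts : measurable_fun setT (fun o => (tilt s (path o))%:E).
    by apply/measurable_EFinP; exact: (measurable_adapted HX (@adapted_tilt s)).
  rewrite ge0_integralZl_EFin ?expR_ge0 //; last 2 first.
  - by move=> o _; rewrite lee_fin tilt_ge0.
  - exact: measurable_funTS.
  rewrite (integral_next_letter HX (@adapted_tilt s) (tilt_ge0 s) p0
    (fun v sv uv => next_letter_prob sv uv)).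
  have seen_bound : (\int[P]_(o in O) (tilt s (path o))%:E <=
      (s.+1%:R * word_prob P X u)%:E)%E.
    apply: le_trans (integral_tilt_seen s); rewrite integral_mkcond.
    apply: ge0_le_integral => //.
    - by move=> o _; apply: erestrict_ge0 => z _; rewrite lee_fin tilt_ge0.
    - by apply/(measurable_restrictT _ mO); exact: measurable_funTS.
    - apply/measurable_EFinP; apply: (measurable_adapted HX (s := s)
        (h := fun x => tilt s x * (has (occ u x) (iota 0 s.+1))%:R)) => x y e.
      rewrite (adapted_tilt e); congr (_ * (nat_of_bool _)%:R); apply: eq_in_has => i.
      by rewrite mem_iota add0n ltnS => /andP[_ it]; exact: (adapted_occ _ it e).
    - move=> o _; rewrite patchE; case: ifPn; rewrite ?inE => oO.
        rewrite lee_fin (_ : has _ _ = true) ?mulr1 //.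
        by apply: (introT hasP); exists s => //; rewrite mem_iota add0n leqnn.
      by rewrite (_ : point = 0%E :> \bar R) // lee_fin mulr_ge0 ?tilt_ge0.
  rewrite muleA -EFinM pua [X in (_ <= X)%E](_ : _ =
    ((2 * p)%:E * (s.+1%:R * word_prob P X u)%:E)%E); last first.
    by rewrite -EFinM mulrACA.
  apply: lee_pmul => //.
  - by rewrite lee_fin mulr_ge0 // expR_ge0.
  - by apply: integral_ge0 => o _; rewrite lee_fin tilt_ge0.
  - by rewrite lee_fin ler_wpM2r // up_le2.
apply: le_trans (leeD (le_trans (integral_tilt_next (@acnt s) (cnt_ge0 s)) IH) step) _.
rewrite -EFinD lee_fin -mulrDl ler_wpM2r ?word_prob_ge0 //.
by rewrite -natr1 !expr2; have : (0 : R) <= s%:R by []; nra.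
Qed.

End tilted_counts.
(** * Deviations of empirical next-letter probabilities *)

Section deviations.
Context {A : countType} {d : measure_display} {Omega : measurableType d} {R : realType}.
Variables (P : probability Omega R) (X : int -> Omega -> A).
Hypotheses (HX : discrete_process X) (Hstat : stationary P X).
Notation path := (sample_path X).
Variable w : seq A.
Hypothesis mem : memory_word P X w.

Lemma occs_rcons_le (u : seq A) a (x : int -> A) s : (occs (rcons u a) x s.+1 <= occs u x s)%N.
Proof.
elim: s => [|s IH]; first by rewrite /occs /= occ_small // size_rcons.
by rewrite occsS [X in (_ <= X)%N]occsS leq_add // occ_rcons; case: occ; case: eqP.
Qed.

Definition deviant (n : nat) (m del : R) (u : seq A) (a : A) (x : int -> A) : Prop :=
  m < (occs (rcons u a) x n.+2)%:R /\
  del < `|(occs (rcons u a) x n.+2)%:R / (occs u x n.+1)%:R - next_prob P X a w|.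

Lemma measurable_deviant n m del u a : measurable [set o | deviant n m del u a (path o)].
Proof.
rewrite (_ : [set o | _] = [set o | [set v | exists x, past x n.+1 = v /\ deviant n m del u a x]
   (past (path o) n.+1)]); first exact: measurable_past.
apply/seteqP; split => o /=; first by exists (path o).
move=> [x [e]]; rewrite /deviant.
by rewrite (adapted_occs _ (leqnn n.+2) e) (adapted_occs _ (leqnSn n.+1) e).
Qed.

(** With [lam = del / 4] or [lam = - (del / 4)], according to the sign of the
    deviation, the exponent is at least
    (del^2 / 4 - 2 * (del / 4)^2) N = del^2 / 8 * N, and [N] exceeds [m]. *)
Lemma tilt_large n m del u a (x : int -> A) : 0 < del -> 0 <= m -> deviant n m del u a x ->
  expR (del ^+ 2 / 8 * m) <=
    tilt P X w u a (del / 4) n.+1 x * (occs (rcons u a) x n.+2)%:R +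
    tilt P X w u a (- (del / 4)) n.+1 x * (occs (rcons u a) x n.+2)%:R.
Proof.
move=> d0 m0 [Cm]; have CN := occs_rcons_le u a x n.+1.
rewrite /tilt; set p := next_prob _ _ _ _.
have C1 : (1 : R) <= (occs (rcons u a) x n.+2)%:R.
  by rewrite ler1n -(ltr0n R); exact: le_lt_trans Cm.
move: Cm C1; rewrite -(ler_nat R) in CN; move: CN.
set C := (occs (rcons u a) x n.+2)%:R; set N := (occs u x n.+1)%:R => CN Cm C1.
have N0 : 0 < N by lra.
rewrite (_ : C / N - p = (C - p * N) / N); last by rewrite mulrBl mulfK // gt_eqF.
rewrite normrM normfV (gtr0_norm N0) ltr_pdivlMr // => dev.
have t0 (l : R) : 0 <= expR (l * (C - p * N) - 2 * l ^+ 2 * N) * C.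
  by rewrite mulr_ge0 ?expR_ge0 //; lra.
have big (l : R) : l ^+ 2 = del ^+ 2 / 16 -> del ^+ 2 / 4 * N <= l * (C - p * N) ->
    expR (del ^+ 2 / 8 * m) <= expR (l * (C - p * N) - 2 * l ^+ 2 * N) * C.
  move=> l2 hl; rewrite -[X in X <= _]mulr1; apply: ler_pM; rewrite ?expR_ge0 //.
  have : del ^+ 2 / 8 * m <= del ^+ 2 / 8 * N.
    by apply: ler_wpM2l; [rewrite divr_ge0 // sqr_ge0|lra].
  by rewrite ler_expR l2; lra.
have [h|h] := leP 0 (C - p * N).
  rewrite ger0_norm // in dev; rewrite -[X in X <= _]addr0; apply: lerD => //.
  apply: big; first by rewrite !expr2; lra.
  rewrite expr2; nra.
rewrite ltr0_norm // in dev; rewrite -[X in X <= _]add0r; apply: lerD => //.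
apply: big; first by rewrite !expr2; lra.
rewrite expr2; nra.
Qed.

Lemma deviant_prob n m del u a : 0 < del -> del <= 1 -> 0 <= m -> suffix w u ->
  (P [set o | deviant n m del u a (path o)] <=
   (expR (- (del ^+ 2 / 8 * m)) * (4 * n.+1%:R ^+ 2) * word_prob P X (rcons u a))%:E)%E.
Proof.
move=> d0 d1 m0 wu; set D := [set o | _].
have mD : measurable D by exact: measurable_deviant.
set K := del ^+ 2 / 8 * m; set pua := word_prob P X _.
have lam1 : `|del / 4| <= 1 / 2 by rewrite ger0_norm; lra.
have lam2 : `|- (del / 4)| <= 1 / 2 by rewrite normrN.
pose g l o := tilt P X w u a l n.+1 (path o) * (occs (rcons u a) (path o) n.+2)%:R.
have g0 l o : 0 <= g l o by rewrite mulr_ge0 // tilt_ge0.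
have mg l : measurable_fun setT (g l).
  apply: (measurable_adapted HX (s := n.+1) (h := fun x =>
    tilt P X w u a l n.+1 x * (occs (rcons u a) x n.+2)%:R)) => x y e.
  by rewrite (adapted_tilt _ _ _ _ _ _ e) (adapted_occs _ (leqnn n.+2) e).
have : ((expR K)%:E * P D <= (2 * n.+1%:R ^+ 2 * pua + 2 * n.+1%:R ^+ 2 * pua)%:E)%E.
  apply: (@le_trans _ _ (\int[P]_o ((g (del / 4) o)%:E + (g (- (del / 4)) o)%:E))%E); last first.
    rewrite ge0_integralD //; last 4 first.
    - by move=> o _; rewrite lee_fin.
    - exact/measurable_EFinP.
    - by move=> o _; rewrite lee_fin.
    - exact/measurable_EFinP.
    by rewrite EFinD; apply: leeD; exact: integral_tilt_occs.
  rewrite -integral_cst // integral_mkcond; apply: ge0_le_integral => //.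
  - by move=> o _; apply: erestrict_ge0 => z _; rewrite lee_fin expR_ge0.
  - by apply/(measurable_restrictT _ mD); exact: measurable_cst.
  - by apply: emeasurable_funD; exact/measurable_EFinP.
  - move=> o _; rewrite patchE -EFinD; case: ifPn; rewrite ?inE => oD.
      by rewrite lee_fin; exact: tilt_large oD.
    by rewrite (_ : point = 0%E :> \bar R) // lee_fin addr_ge0.
rewrite -[in X in X -> _](fineK (fin_num_measure P D mD)) -EFinM lee_fin => h.
rewrite -[X in (X <= _)%E](fineK (fin_num_measure P D mD)) lee_fin.
rewrite expRN -mulrA ler_pdivlMl ?expR_gt0 //; apply: le_trans h _; lra.
Qed.

Definition some_deviant n m del : set Omega :=
  [set o | exists u a, suffix w u /\ deviant n m del u a (path o)].

Lemma measurable_past_letter (B : set (seq A * A)) s :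
  measurable [set o | B (past (path o) s, X s%:Z o)].
Proof.
rewrite (_ : [set o | _] = [set o | [set v | exists u a, v = rcons u a /\ B (u, a)]
   (past (path o) s.+1)]); first exact: measurable_past.
apply/seteqP; split => o /=.
  by move=> h; exists (past (path o) s), (X s%:Z o); rewrite pastS.
move=> [u [a [e Bua]]]; move: e; rewrite pastS => /eqP.
by rewrite eqseq_rcons => /andP[/eqP -> /eqP]; rewrite /sample_path => ->.
Qed.

(** For each length of [u], the pairs [(u, a)] are the values of the first
    letters of the path, so the bounds of [deviant_prob] sum to at most the
    common factor.  Longer words do not occur in the sample, which leaves
    [n.+1] lengths. *)
Lemma some_deviant_prob n m del : 0 < del -> del <= 1 -> 0 <= m ->
  measurable (some_deviant n m del) /\
  (P (some_deviant n m del) <=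
   (n.+1%:R * (expR (- (del ^+ 2 / 8 * m)) * (4 * n.+1%:R ^+ 2)))%:E)%E.
Proof.
move=> d0 d1 m0; set K := expR _ * _.
have K0 : 0 <= K by rewrite mulr_ge0 ?expR_ge0 // mulr_ge0 // sqr_ge0.
pose F (l : nat) (ua : seq A * A) : set Omega :=
  [set o | [/\ size ua.1 = l, suffix w ua.1 & deviant n m del ua.1 ua.2 (path o)]].
have mF l ua : measurable (F l ua).
  have [h|h] := pselect (size ua.1 = l /\ suffix w ua.1).
    rewrite (_ : F l ua = [set o | deviant n m del ua.1 ua.2 (path o)]).
      exact: measurable_deviant.
    by apply/seteqP; split => o; [case|case: h].
  by rewrite (_ : F l ua = set0) //; apply/seteqP; split => // o [h1 h2 _]; apply: h.
have mFl l : measurable (\bigcup_ua F l ua).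
  by apply: countable_bigcupT_measurable => //; exact: countableP.
have PF l : (P (\bigcup_ua F l ua) <= K%:E)%E.
  apply: (@union_bound_fibers _ _ _ P _ (fun o => (past (path o) l, X l%:Z o))) => //.
    by move=> B; exact: (measurable_past_letter B l).
  move=> [u a]; have [ul|ul] := eqVneq (size u) l; last first.
    rewrite (_ : F l (u, a) = set0) ?measure0 ?mule_ge0 //.
    by apply/seteqP; split => // o [/= /eqP]; rewrite (negbTE ul).
  have [wu|wu] := boolP (suffix w u); last first.
    rewrite (_ : F l (u, a) = set0) ?measure0 ?mule_ge0 //.
    by apply/seteqP; split => // o [/= _]; rewrite (negbTE wu).
  rewrite (_ : F l (u, a) = [set o | deviant n m del u a (path o)]); last first.
    by apply/seteqP; split => o //; case.
  rewrite (_ : _ @^-1` [set (u, a)] = [set o | past (path o) (size (rcons u a)) = rcons u a]).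
    by rewrite past_prob // word_probE // -EFinM; exact: deviant_prob.
  rewrite size_rcons ul; apply/seteqP; split => o /=; rewrite pastS.
    by case=> -> <-.
  by move=> /eqP; rewrite eqseq_rcons => /andP[/eqP -> /eqP <-].
have cover : some_deviant n m del = \big[setU/set0]_(l < n.+1) \bigcup_ua F l ua.
  rewrite -(bigcup_mkord n.+1 (fun l => \bigcup_ua F l ua)); apply/seteqP; split => o.
    move=> [u [a [wu dv]]]; exists (size u); last by exists (u, a).
    rewrite /= ltnNge; apply/negP => ul.
    have [+ _] := dv; rewrite ltNge => /negP; apply.
    rewrite (_ : occs _ _ _ = 0%N) //; apply/eqP; rewrite eqn0Ngt -has_count; apply/hasPn => t.
    by rewrite mem_iota add0n => /= tn; rewrite occ_small // size_rcons; lia.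
  by move=> [l _ [[u a] _ [_ wu dv]]]; exists u, a.
rewrite cover; split; first exact: bigsetU_measurable.
apply: le_trans (_ : (\sum_(l < n.+1) P (\bigcup_ua F l ua) <= _)%E).
  by apply: (@Boole_inequality _ _ _ P (fun l => \bigcup_ua F l ua) n.+1) => i _; exact: mFl.
apply: le_trans (_ : (\sum_(l < n.+1) K%:E <= _)%E); first exact: lee_sum.
by rewrite sumEFin sumr_const card_ord mulr_natl.
Qed.

End deviations.
(** * Stretched exponentials and empirical frequencies *)

Section stretched_exponential.
Context {R : realType}.

Lemma powR_ge_near (g M : R) : 0 < g -> \forall n \near \oo, M <= n%:R `^ g.
Proof.
move=> g0; near=> n.
have [M0|M0] := leP M 0; first by rewrite (le_trans M0) // powR_ge0.
have -> : M = (M `^ g^-1) `^ g by rewrite -powRrM mulVf ?gt_eqF // powRr1 // ltW.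
apply: ge0_ler_powR; rewrite ?nnegrE ?powR_ge0 //; first exact: ltW.
by near: n; exact: nbhs_infty_ger.
Unshelve. all: by end_near. Qed.

(** Any power would do; the fifth beats the cubic factor of the deviation
    bounds and leaves an inverse square. *)
Lemma expRN_le_inv_pow5 (al : R) : 0 < al ->
  exists2 C : R, 0 <= C &
  forall N : R, 1 <= N -> expR (- (N `^ al / 32)) <= C / N ^+ 5.
Proof.
move=> al0; pose k := Num.bound (5 / al).
have kal : 5 <= al * k.+1%:R.
  have /archi_boundP : 0 <= 5 / al by rewrite divr_ge0 // ltW.
  rewrite ltr_pdivrMr // -/k mulrC => h; rewrite -[k.+1%:R]natr1 mulrDr mulr1; lra.
exists (k.+1`!%:R * 32 ^+ k.+1); first by rewrite mulr_ge0.
move=> N N1; have N0 : 0 < N by lra.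
rewrite expRN -[leRHS]invrK lef_pV2 ?posrE ?expR_gt0 ?invr_gt0 //; last first.
  by rewrite divr_gt0 ?exprn_gt0 // mulr_gt0 ?exprn_gt0 // ltr0n fact_gt0.
have y0 : 0 <= N `^ al / 32 by rewrite divr_ge0 // powR_ge0.
apply: le_trans (expR_ge1Dxn k y0); rewrite -[X in X <= _]add0r; apply: lerD => //.
rewrite invf_div invfM mulrA mulrAC; apply: ler_wpM2r.
  by rewrite invr_ge0.
rewrite expr_div_n ler_pM2r ?invr_gt0 ?exprn_gt0 //.
by rewrite -!powR_mulrn ?powR_ge0 // -?powRrM; [exact: ler_powR|exact: ltW].
Qed.

(** The terms are compared with the telescoping differences
    [n.+1%:R^-1 - n.+2%:R^-1]. *)
Lemma stretched_exponential_summable (al : R) : 0 < al ->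
  (\sum_(n <oo) (n.+2%:R * (expR (- (n.+1%:R `^ al / 32)) * (4 * n.+2%:R ^+ 2)))%:E
    < +oo :> \bar R)%E.
Proof.
move=> al0; have [C C0 hC] := expRN_le_inv_pow5 al0.
pose c (n : nat) : R := n.+2%:R * (expR (- (n.+1%:R `^ al / 32)) * (4 * n.+2%:R ^+ 2)).
have c0 n : 0 <= c n by rewrite !mulr_ge0 ?expR_ge0 // sqr_ge0.
have cC n : c n <= 64 * C * (n.+1%:R^-1 - n.+2%:R^-1).
  have n1 : (1 : R) <= n.+1%:R by rewrite ler1n.
  have e2 : (n.+2%:R : R) = n.+1%:R + 1 by rewrite -[n.+2%:R]natr1.
  rewrite /c e2; set N := n.+1%:R in n1 *; have := hC _ n1; set E := expR _ => hE.
  have N0 : 0 < N by lra.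
  rewrite (_ : N^-1 - (N + 1)^-1 = (N * (N + 1))^-1); last first.
    by field; apply/andP; split; apply: lt0r_neq0; lra.
  rewrite ler_pdivlMr; last by rewrite mulr_gt0 //; lra.
  have E0 : 0 <= E := expR_ge0 _.
  have hE5 : E * N ^+ 5 <= C by rewrite -ler_pdivlMr // exprn_gt0.
  apply: le_trans (_ : 64 * (E * N ^+ 5) <= _); last by rewrite ler_wpM2l.
  rewrite (_ : _ * (N * (N + 1)) = E * (4 * (N * (N + 1) ^+ 4))); last by ring.
  rewrite [leRHS]mulrCA ler_wpM2l // (_ : 64 * N ^+ 5 = 4 * (N * (2 * N) ^+ 4)); last by ring.
  rewrite ler_wpM2l // ler_wpM2l ?(ltW N0) //.
  by apply: lerXn2r; rewrite ?nnegrE; lra.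
have partial n : \sum_(0 <= i < n) c i <= 64 * C.
  apply: le_trans (ler_sum _ (fun i _ => cC i)) _.
  rewrite -mulr_sumr (@GRing.telescope_sumr_eq _ _ _ (fun i => - i.+1%:R^-1)) //; last first.
    by move=> i _; rewrite opprK addrC.
  rewrite invr1 opprK -[leRHS]mulr1; apply: ler_wpM2l; first by rewrite mulr_ge0.
  by rewrite addrC gerBl invr_ge0.
apply: le_lt_trans (ltry (64 * C)).
apply: lime_le; first by apply: is_cvg_nneseries => n _ _; rewrite lee_fin c0.
by apply: nearW => n; rewrite sumEFin lee_fin; exact: partial.
Qed.

End stretched_exponential.

Section frequencies_of_words.
Context {A : countType} {d : measure_display} {Omega : measurableType d} {R : realType}.
Variables (P : probability Omega R) (X : int -> Omega -> A).
Notation path := (sample_path X).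

Lemma ae_forall_countable (T : countType) (Q : T -> Omega -> Prop) :
  (forall y, {ae P, forall o, Q y o}) -> {ae P, forall o, forall y, Q y o}.
Proof.
move=> h.
have : {ae P, forall o, forall k, if unpickle k is Some y then Q y o else True}.
  by apply: ae_foralln => k; case: unpickle => [y|]; [exact: h|exact: aeW].
by apply: filterS => o ho y; have := ho (pickle y); rewrite pickleK.
Qed.

Hypotheses (HX : discrete_process X) (Hstat : stationary P X) (Herg : ergodic P X).

Lemma occsD_le (u : seq A) (x : int -> A) n k : (occs u x (n + k) <= occs u x n + k)%N.
Proof.
elim: k => [|k IH]; first by rewrite !addn0.
by rewrite !addnS occsS; have := leq_b1 (occ u x (n + k)); lia.
Qed.

Lemma occs_mono (u : seq A) (x : int -> A) m n : (m <= n)%N -> (occs u x m <= occs u x n)%N.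
Proof. by move=> mn; rewrite -(subnKC mn) /occs iotaD count_cat leq_addr. Qed.

Lemma occs_hits (u : seq A) (x : int -> A) n : occs u x n.+1 = (occ u x 0 + hits [:: u] x n)%N.
Proof.
rewrite /occs /=; congr addn; rewrite -(addn0 1%N) iotaDl count_map /hits.
by apply: eq_count => t /=; rewrite orbF.
Qed.

Lemma occs_cvg_ae : {ae P, forall o, forall u k,
  (occs u (path o) (n + k))%:R / n%:R @[n --> \oo] --> word_prob P X u}.
Proof.
apply: ae_forall_countable => u; have := hits_cvg_ae HX Hstat Herg [:: u].
apply: filterS => o h k.
rewrite (_ : word_prob P X u = fine (P [set o | ends_in [:: u] (path o)])); last first.
  congr (fine (P _)); apply/seteqP; split => z; rewrite /ends_in /= orbF.
    by move=> ->.
  by move/eqP.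
apply: (@cvg_ratio_bounded_diff R _ _ k.+1 _ _ _ h) => n.
  have := occs_hits u (path o) n; have := occsD_le u (path o) n 1.
  have := occs_mono u (path o) (leq_addr k n); rewrite addn1.
  by case: (occ _ _ 0) => /=; lia.
have := occs_hits u (path o) n; have := occsD_le u (path o) n k.
have := occs_mono u (path o) (leqnSn n).
by case: (occ _ _ 0) => /=; lia.
Qed.

Definition frequency_ratio (a : A) (u : seq A) (x : int -> A) (n : nat) : R :=
  (occs (rcons u a) x n.+2)%:R / (occs u x n.+1)%:R.

Lemma frequency_ratio01 a u x n : 0 <= frequency_ratio a u x n <= 1.
Proof.
rewrite /frequency_ratio divr_ge0 //=.
have [->|N0] := eqVneq (occs u x n.+1) 0%N; first by rewrite invr0 mulr0.
by rewrite ler_pdivrMr ?ltr0n ?lt0n // mul1r ler_nat occs_rcons_le.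
Qed.

Lemma frequency_ratio_cvg_ae : {ae P, forall o, forall a u, 0 < word_prob P X u ->
  frequency_ratio a u (path o) n @[n --> \oo] --> next_prob P X a u}.
Proof.
apply: filterS occs_cvg_ae => o h a u pu; rewrite next_probE //.
pose F n : R := (occs (rcons u a) (path o) (n + 2))%:R / n%:R *
  ((occs u (path o) (n + 1))%:R / n%:R)^-1.
have h2 : F n @[n --> \oo] --> word_prob P X (rcons u a) / word_prob P X u.
  by apply: cvgM; [exact: h|apply: cvgV; [exact: lt0r_neq0|exact: h]].
apply: cvg_trans h2; apply: near_eq_cvg; near=> n.
have n0 : n%:R != 0 :> R by rewrite pnatr_eq0 -lt0n; near: n; exact: nbhs_infty_gt.
by rewrite /F addn2 addn1 invf_div mulrA divfK.
Unshelve. all: by end_near. Qed.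

End frequencies_of_words.
(** * Consistency of the test *)

Section test_consistency.
Context {A : countType} {d : measure_display} {Omega : measurableType d} {R : realType}.
Variables (P : probability Omega R) (X : int -> Omega -> A).
Hypotheses (HX : discrete_process X) (Hstat : stationary P X) (Herg : ergodic P X).
Notation path := (sample_path X).
Variables (gamma beta : R).
Hypotheses (Hgamma : 0 < gamma < 1) (Hbeta : 0 < beta < (1 - gamma) / 2).

(** The deviation [n `^ (- beta) / 2] and the count [n `^ (1 - gamma)] give the
    exponent [n `^ (1 - gamma - 2 * beta) / 32] in the deviation bound; it is a
    positive power of [n] by the condition on [beta].  Half of the tolerance of
    the test is used because the test compares two empirical probabilities. *)
Lemma frequent_successors_ae (w : seq A) : memory_word P X w ->
  {ae P, forall o, \forall n \near \oo, forall u a, suffix w u ->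
    n%:R `^ (1 - gamma) < (occs (rcons u a) (path o) n.+2)%:R ->
    `|frequency_ratio a u (path o) n - next_prob P X a w| <= n%:R `^ (- beta) / 2}.
Proof.
move=> mem; have /andP[g0 g1] := Hgamma; have /andP[b0 b1] := Hbeta.
pose m (n : nat) : R := n.+1%:R `^ (1 - gamma).
pose del (n : nat) : R := n.+1%:R `^ (- beta) / 2.
pose al := 1 - gamma - 2 * beta.
have al0 : 0 < al by rewrite /al; lra.
have N0 (n : nat) : (0 : R) < n.+1%:R by rewrite ltr0n.
have m0 n : 0 <= m n by rewrite powR_ge0.
have d0 n : 0 < del n by rewrite divr_gt0 // powR_gt0.
have d1 n : del n <= 1.
  have : n.+1%:R `^ (- beta) <= n.+1%:R `^ 0 :> R by apply: ler_powR; [rewrite ler1n|lra].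
  by rewrite powRr0 /del; lra.
have e n : del n ^+ 2 / 8 * m n = n.+1%:R `^ al / 32.
  rewrite /del /m /al (_ : 1 - gamma - 2 * beta = - beta + - beta + (1 - gamma)); last by ring.
  have powD (r s : R) : n.+1%:R `^ (r + s) = n.+1%:R `^ r * n.+1%:R `^ s.
    by rewrite powRD // (lt0r_neq0 (N0 n)) implybT.
  by rewrite !powD; field.
pose F n := some_deviant P X w n.+1 (m n) (del n).
have FP n : measurable (F n) /\ (P (F n) <=
    (n.+2%:R * (expR (- (n.+1%:R `^ al / 32)) * (4 * n.+2%:R ^+ 2)))%:E)%E.
  by rewrite -e; apply: some_deviant_prob.
have F0 : P (lim_sup_set F) = 0%E.
  apply: lim_sup_set_cvg0; first by move=> n; have [] := FP n.
  apply: le_lt_trans (stretched_exponential_summable al0).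
  by apply: lee_nneseries => // n _; have [] := FP n.
exists (lim_sup_set F); split => //.
  apply: bigcapT_measurable => n; apply: bigcup_measurable => k _.
  by have [] := FP k.
move=> o /= no; apply: contrapT => nF; apply: no.
have {nF} [k _ hk] : (\bigcup_k ~` (\bigcup_(j in [set j | (k <= j)%N]) F j)) o.
  by rewrite -setC_bigcap.
exists k.+1 => //= n; case: n => // n kn u a wu fr; rewrite leNgt; apply/negP => dv.
by apply: hk; exists n => //; exists u, a.
Qed.

Lemma occs_suffix (u v : seq A) x n : suffix u v -> (occs v x n <= occs u x n)%N.
Proof. by move=> uv; apply: sub_count => t; exact: suffix_trans. Qed.

Lemma suffix_rcons2 (u v : seq A) a : suffix u v -> suffix (rcons u a) (rcons v a).
Proof. by move=> uv; rewrite suffix_rcons eqxx. Qed.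

Lemma PTEST_memory_ae (w : seq A) : memory_word P X w ->
  {ae P, forall o, \forall n \near \oo, PTEST gamma beta (path o) n w}.
Proof.
move=> mem; have := frequent_successors_ae mem; apply: filterS => o.
apply: filterS => n hn; rewrite /PTEST /NTEST /Delta_hat.
set S := [set r | _].
have [->|/set0P S0] := eqVneq S set0; first by rewrite sup0 powR_ge0.
apply: ge_sup => // r [i [z [a [/andP[i1 iN] sz /frequent_wordsE[_ fr] ->]]]].
rewrite !emp_probE -/(frequency_ratio a w _ n) -/(frequency_ratio a (z ++ w) _ n).
have wzw : suffix w (z ++ w) by exact: suffix_suffix.
have h1 := hn _ a wzw fr.
have h2 : `|frequency_ratio a w (path o) n - next_prob P X a w| <= n%:R `^ (- beta) / 2.
  apply: hn; first exact: suffix_refl.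
  by apply: lt_le_trans fr _; rewrite ler_nat; apply: occs_suffix; exact: suffix_rcons2.
apply: le_trans (ler_distD (next_prob P X a w) _ _) _.
by rewrite [X in _ + X <= _]distrC [leRHS](splitr) lerD.
Qed.

Lemma not_memory_word w : ~ memory_word P X w -> exists a z,
  [/\ (0 < size z)%N, 0 < word_prob P X (z ++ rcons w a) &
      next_prob P X a w != next_prob P X a (z ++ w)].
Proof.
move=> /existsNP[a] /existsNP[z] /not_implyP[z0] /not_implyP[pz /eqP ne].
by exists a, z.
Qed.

(** A word [z] and a letter [a] witness the failure.  The two empirical
    probabilities settle at distance [D] of each other while the tolerance
    tends to 0, and [z ++ rcons w a] is frequent since its count grows
    linearly. *)
Lemma PTEST_not_memory_ae (w : seq A) : ~ memory_word P X w ->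
  {ae P, forall o, \forall n \near \oo, ~~ PTEST gamma beta (path o) n w}.
Proof.
move=> /not_memory_word[a [z [z0 py ne]]].
have /andP[g0 g1] := Hgamma; have /andP[b0 b1] := Hbeta.
have py' : 0 < word_prob P X (rcons (z ++ w) a) by rewrite rcons_cat.
have pzw : 0 < word_prob P X (z ++ w).
  apply: lt_le_trans py' _.
  by rewrite -subr_ge0 -(word_prob_rcons_split HX Hstat) fine_ge0.
have pw : 0 < word_prob P X w.
  by apply: lt_le_trans pzw _; apply: word_prob_suffix => //; exact: suffix_suffix.
apply: filterS2 (frequency_ratio_cvg_ae HX Hstat Herg) (occs_cvg_ae HX Hstat Herg).
move=> o ratio freq.
have := ratio a w pw; have := ratio a _ pzw.
set p1 := next_prob P X a (z ++ w); set p2 := next_prob P X a w => c1 c2.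
have gap : 0 < `|p2 - p1| by rewrite normr_gt0 subr_eq0.
set D := `|p2 - p1| in gap *.
have e4 : 0 < D / 4 by rewrite divr_gt0.
have y4 : 0 < word_prob P X (rcons (z ++ w) a) / 2 by rewrite divr_gt0.
move/cvgrPdist_lt: c1 => /(_ _ e4) c1; move/cvgrPdist_lt: c2 => /(_ _ e4) c2.
have /cvgrPdist_lt /(_ _ y4) c3 := freq (rcons (z ++ w) a) 2%N.
have c4 := powR_ge_near (2 / word_prob P X (rcons (z ++ w) a)) g0.
have c5 := powR_ge_near (4 / D) b0.
near=> n; rewrite /PTEST /NTEST -ltNge.
have n0 : (0 : R) < n%:R by rewrite ltr0n; near: n; exact: nbhs_infty_gt.
have d1 : `|p1 - frequency_ratio a (z ++ w) (path o) n| < D / 4 by near: n.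
have d2 : `|p2 - frequency_ratio a w (path o) n| < D / 4 by near: n.
have d3 : `|word_prob P X (rcons (z ++ w) a) -
    (occs (rcons (z ++ w) a) (path o) (n + 2))%:R / n%:R| <
    word_prob P X (rcons (z ++ w) a) / 2 by near: n.
have d4 : 2 / word_prob P X (rcons (z ++ w) a) <= n%:R `^ gamma by near: n.
have d5 : 4 / D <= n%:R `^ beta by near: n.
have zn : (size z <= n)%N by near: n; exact: nbhs_infty_ge.
rewrite addn2 in d3.
have small : n%:R `^ (- beta) <= D / 4.
  rewrite powRN -[leRHS]invrK lef_pV2 ?posrE ?powR_gt0 ?invr_gt0 //.
  by rewrite invf_div.
have fr : n%:R `^ (1 - gamma) < (occs (rcons (z ++ w) a) (path o) n.+2)%:R.
  have h : word_prob P X (rcons (z ++ w) a) / 2 <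
      (occs (rcons (z ++ w) a) (path o) n.+2)%:R / n%:R.
    by move: d3; rewrite ltr_distl => /andP[]; lra.
  rewrite powRB; last by rewrite (lt0r_neq0 n0) implybT.
  rewrite powRr1; last exact: ltW.
  move: h; rewrite ltr_pdivlMr // mulrC; apply: le_lt_trans.
  rewrite ler_pM2l // -[leRHS]invrK lef_pV2 ?posrE ?powR_gt0 ?invr_gt0 //.
  by rewrite invf_div.
apply: le_lt_trans small _.
apply: lt_le_trans (_ : `|frequency_ratio a w (path o) n -
    frequency_ratio a (z ++ w) (path o) n| <= _); last first.
  apply: ub_le_sup.
    exists 1 => r [i [z' [b [_ _ _ ->]]]].
    rewrite !emp_probE -/(frequency_ratio b w _ n) -/(frequency_ratio b (z' ++ w) _ n).
    have /andP[r0 r1] : (0 : R) <= frequency_ratio b w (path o) n <= 1 :=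
      frequency_ratio01 _ _ _ _.
    have /andP[s0 s1] : (0 : R) <= frequency_ratio b (z' ++ w) (path o) n <= 1 :=
      frequency_ratio01 _ _ _ _.
    by rewrite ler_norml; apply/andP; split; lra.
  exists (size z), z, a; split => //; first by rewrite z0.
    by apply/frequent_wordsE; rewrite size_rcons size_cat addnC.
  by rewrite !emp_probE.
have : D <= `|p2 - frequency_ratio a w (path o) n| +
   `|frequency_ratio a w (path o) n - frequency_ratio a (z ++ w) (path o) n| +
   `|p1 - frequency_ratio a (z ++ w) (path o) n|.
  rewrite [X in _ + X]distrC -addrA.
  apply: le_trans (ler_distD (frequency_ratio a w (path o) n) _ _) _.
  by rewrite lerD2l; exact: ler_distD.
lra.
Unshelve. all: by end_near. Qed.

Lemma PTEST_ae : {ae P, forall o, forall w : seq A, \forall n \near \oo,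
  PTEST gamma beta (path o) n w = `[< memory_word P X w >]}.
Proof.
apply: ae_forall_countable => w; have [mem|nmem] := pselect (memory_word P X w).
  have := PTEST_memory_ae mem; apply: filterS => o; apply: filterS => n ->.
  by rewrite asboolT.
have := PTEST_not_memory_ae nmem; apply: filterS => o; apply: filterS => n /negbTE ->.
by rewrite asboolF.
Qed.

End test_consistency.
(** * The words selected by the construction *)

Lemma limn_einf_ge (R : realType) (u v : nat -> R) (c : R) :
  (forall n, v n <= u n) -> v n @[n --> \oo] --> c ->
  (c%:E <= limn_einf (fun n => (u n)%:E))%E.
Proof.
move=> vu vc.
have vc' : (v n)%:E @[n --> \oo] --> c%:E by apply/cvg_EFin => //; exact: nearW.
have [<- _] := cvg_limn_einf_sup vc'.
rewrite !limn_einf_lim; apply: lee_lim; [exact: is_cvg_einfs|exact: is_cvg_einfs|].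
apply: nearW => n; apply: le_ereal_inf_tmp => _ [k /= nk <-].
apply: le_trans (_ : ((v k)%:E <= _)%E); last by rewrite lee_fin.
by apply: ereal_inf_lbound; exists k.
Qed.

Section coverage.
Context {R : realType} {A : countType}.
Variables (gamma beta eps : R) (w : nat -> seq A) (w0 : w 0%N = [::]).
Implicit Types (x : int -> A) (mem : pred (seq A)).

(** The words of index at most [j] that pass [mem], which is either the test or
    the true memory property; the covered set depends on the words only
    through this list. *)
Definition selected mem j := [seq w i | i <- iota 0 j.+1 & mem (w i)].

Lemma has_selected mem j (f : pred (seq A)) :
  has f (selected mem j) = has (fun i => mem (w i) && f (w i)) (iota 0 j.+1).
Proof.
rewrite /selected has_map; apply/hasP/hasP => -[i].
  by rewrite mem_filter => /andP[mi ij] /= fi; exists i => //; rewrite mi.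
by move=> ij /andP[mi fi]; exists i => //; rewrite mem_filter mi.
Qed.

Lemma mem_covered x n j (k : 'I_n.+1) :
  (k \in covered gamma beta w x n j) =
  has (fun u => occ u x k.+1) (selected (PTEST gamma beta x n) j).
Proof.
rewrite has_selected; apply/bigcupP/hasP => [[i Pi]|[i]].
  by rewrite mem_occ_set // => h; exists (i : nat); rewrite ?mem_iota ?add0n ?ltn_ord ?Pi.
rewrite mem_iota add0n => /= ij /andP[Pi h].
by exists (Ordinal ij) => //; rewrite mem_occ_set.
Qed.

Lemma card_ord_count (N : nat) (p : pred nat) (S : {set 'I_N}) :
  (forall k : 'I_N, (k \in S) = p k) -> #|S| = count p (iota 0 N).
Proof.
move=> Sp; rewrite -sum1_card -sum1_count -[N in iota 0 N]subn0 -/(index_iota 0 N).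
by rewrite big_mkord; apply: eq_bigl => k; exact: Sp.
Qed.

Lemma card_covered x n j :
  #|covered gamma beta w x n j| = hits (selected (PTEST gamma beta x n) j) x n.+1.
Proof. by apply: card_ord_count => k; exact: mem_covered. Qed.

Lemma eq_selected mem mem' J j : (j <= J)%N ->
  (forall i, (i <= J)%N -> mem (w i) = mem' (w i)) -> selected mem j = selected mem' j.
Proof.
move=> jJ e; congr map; apply: eq_in_filter => i; rewrite mem_iota => /andP[_ ij].
by apply: e; rewrite (leq_trans _ jJ) // -ltnS.
Qed.

Definition enough x n j : bool :=
  1 - eps / 2 <= (hits (selected (PTEST gamma beta x n) j) x n.+1)%:R / n.+1%:R.

Lemma thetaE x n : theta gamma beta eps w x n = find (enough x n) (iota 0 n).
Proof. by apply: eq_find => j; rewrite card_covered. Qed.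

Lemma theta_le x n J : (J < n)%N -> enough x n J -> (theta gamma beta eps w x n <= J)%N.
Proof.
move=> Jn e; rewrite thetaE leqNgt; apply/negP => /(before_find 0%N).
by rewrite nth_iota // add0n e.
Qed.

Lemma theta_ge x n j : (j <= n)%N -> (forall i, (i < j)%N -> ~~ enough x n i) ->
  (j <= theta gamma beta eps w x n)%N.
Proof.
move=> jn h; rewrite thetaE leqNgt; apply/negP => fj.
have fn : (find (enough x n) (iota 0 n) < n)%N := leq_trans fj jn.
have := nth_find 0%N (_ : has (enough x n) (iota 0 n)).
rewrite has_find size_iota => /(_ fn); rewrite nth_iota // add0n.
by apply/negP; exact: h.
Qed.

Lemma good_timeE x n : good_time gamma beta eps w x n =
  has (fun u => occ u x n.+1) (selected (PTEST gamma beta x n) (theta gamma beta eps w x n)).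
Proof. by rewrite /good_time mem_covered. Qed.

Lemma kappa_minimal x n i : PTEST gamma beta x n (w i) -> occ (w i) x n.+1 ->
  let k := kappa gamma beta w x n in
  [/\ (k <= i)%N, PTEST gamma beta x n (w k) &
      block x (n%:Z - (size (w k))%:Z + 1) n%:Z = w k].
Proof.
move=> Pi oi.
have bi : block x (n%:Z - (size (w i))%:Z + 1) n%:Z == w i.
  have si : (size (w i) <= n.+1)%N by have := size_suffix oi; rewrite size_past.
  by move: oi; rewrite occE //; congr (block _ _ _ == _); lia.
rewrite /kappa; case: pselect => [exi|]; last by case; exists i; rewrite bi Pi.
case: ex_minnP => k /andP[/eqP bk Pk] kmin; split => //.
by apply: kmin; rewrite bi Pi.
Qed.

End coverage.
(** * Memory words describe the conditional law and cover the process *)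

Section conclusion.
Context {d : measure_display} {Omega : measurableType d} {R : realType}.
Variables (P : probability Omega R) (A : countType) (X : int -> Omega -> A).
Hypotheses (HX : discrete_process X) (Hstat : stationary P X) (Herg : ergodic P X)
  (Hfm : finitarily_markovian P X).
Notation path := (sample_path X).
Variables (w : nat -> seq A) (Hw : word_list w).

Let memory : pred (seq A) := fun u => `[< memory_word P X u >].

(** For each [n], the pasts of probability 0 form a countable union of null
    events: the union bound with factor 0. *)
Lemma past_positive_ae : {ae P, forall o, forall n, 0 < word_prob P X (past (path o) n)}.
Proof.
apply: ae_foralln => n.
pose F (v : seq A) : set Omega := [set o | past (path o) n = v /\ word_prob P X v = 0].
have mF v : measurable (F v).
  exact: (measurable_past HX [set u | u = v /\ word_prob P X v = 0]).
have mY (B : set (seq A)) : measurable ((fun o => past (path o) n) @^-1` B).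
  exact: measurable_past.
have PF : (P (\bigcup_v F v) <= 0%:E)%E.
  apply: (@union_bound_fibers _ _ _ P _ _ mY) => // v; rewrite mul0e.
  have [->|/set0P[z0 [ov pv]]] := eqVneq (F v) set0; first by rewrite measure0.
  apply: le_trans (_ : (P [set o | past (path o) (size v) = v] <= 0)%E).
    apply: le_measure; rewrite ?inE //; first exact: (measurable_past HX [set v]).
    by move=> z [zv _] /=; rewrite -{1}ov size_past.
  by rewrite past_prob // word_probE // pv.
exists (\bigcup_v F v); split.
- by apply: countable_bigcupT_measurable => //; exact: countableP.
- by apply/eqP; rewrite eq_le PF measure_ge0.
- move=> o /= h; exists (past (path o) n) => //; split => //.
  apply/eqP; rewrite eq_le word_prob_ge0 // andbT leNgt; exact/negP.
Qed.

Lemma memory_coverage (e : R) : 0 < e ->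
  exists J, 1 - e < fine (P [set o | ends_in (selected w memory J) (path o)]).
Proof.
move=> e0; pose E j := [set o | ends_in (selected w memory j) (path o)].
have mE j : measurable (E j) by exact: measurable_ends_in_event.
have ndE : nondecreasing_seq E.
  move=> i j ij; apply/subsetPset => o; rewrite /E /ends_in /= !has_selected.
  move=> /hasP[k ki hk]; apply/hasP; exists k => //.
  by move: ki; rewrite !mem_iota !add0n !ltnS => /leq_trans; exact.
have full : {ae P, forall o, (\bigcup_j E j) o}.
  apply: filterS Hfm => o; rewrite /memory_length => /ereal_inf_lt[_ [K hK <-] _].
  have [_ _ allw _] := Hw; have [i wi] := allw (block (path o) (- K%:Z + 1) 0).
  exists i => //; rewrite /E /ends_in /= has_selected; apply/hasP; exists i.
    by rewrite mem_iota add0n leqnn.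
  rewrite wi; apply/andP; split; first by apply/asboolP; apply/memory_propertyE.
  rewrite [X in size X](@block_mkseq _ _ _ _ K) ?size_mkseq //; lia.
have PE : P (\bigcup_j E j) = 1%E.
  have [N [mN N0 sN]] := full.
  have mU : measurable (\bigcup_j E j) by exact: bigcupT_measurable.
  have : P (~` \bigcup_j E j) = 0%E.
    by apply: (@subset_measure0 _ _ _ P _ N) => //; exact: measurableC.
  rewrite probability_setC // -(fineK (fin_num_measure P _ mU)) -EFinB => -[h].
  by congr (_%:E); lra.
have cvgE : P (E j) @[j --> \oo] --> 1%E.
  rewrite -PE; apply: nondecreasing_cvg_mu => //; exact: bigcupT_measurable.
have : fine (P (E j)) @[j --> \oo] --> (1 : R) by exact: fine_cvg.
move=> /cvgrPdist_lt /(_ _ e0) [J _ /(_ J (leqnn J)) /=] h; exists J.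
by move: h; rewrite ltr_norml => /andP[_]; rewrite -/(E J); lra.
Qed.

Lemma next_prob_given_pastE n a o u : memory u -> occ u (path o) n.+1 ->
  0 < word_prob P X (past (path o) n.+1) ->
  next_prob_given_past P X n a o = next_prob P X a u.
Proof.
move=> /asboolP mem uo pv; set v := past (path o) n.+1 in pv.
have blockE x : block x 0 n%:Z = past x n.+1 :> seq A.
  rewrite (@block_mkseq _ _ _ _ n.+1); last lia.
  by apply: eq_mkseq => i; rewrite add0r.
rewrite /next_prob_given_past /cond_prob.
rewrite (_ : [set o' | block _ _ _ = _] = [set o' | past (path o') n.+1 = v]); last first.
  by apply/seteqP; split => z /=; rewrite !blockE.
have sv : size v = n.+1 by rewrite size_past.
have uv : suffix u v := uo.
clearbody v.
rewrite (_ : _ `&` _ = [set o' | past (path o') (size (rcons v a)) = rcons v a]); last first.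
  rewrite size_rcons sv; apply/seteqP; split => z /=; rewrite (pastS _ n.+1).
    by move=> [e ->]; rewrite -e /sample_path; congr (rcons _ (X _ z)); lia.
  move=> /eqP; rewrite eqseq_rcons => /andP[/eqP -> /eqP <-]; split => //.
  by rewrite /sample_path; congr (X _ z); lia.
rewrite past_prob // -sv past_prob // !word_probE //=.
by rewrite (memory_word_next HX Hstat a mem uv) mulfK // gt_eqF.
Qed.

End conclusion.
(** * Estimates along good times and their density *)

Section main_proof.
Context {d : measure_display} {Omega : measurableType d} {R : realType}.
Variables (P : probability Omega R) (A : countType) (X : int -> Omega -> A).
Hypotheses (HX : discrete_process X) (Hstat : stationary P X) (Herg : ergodic P X)
  (Hfm : finitarily_markovian P X).
Notation path := (sample_path X).
Variables (gamma beta eps : R).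
Hypotheses (Hgamma : 0 < gamma < 1) (Hbeta : 0 < beta < (1 - gamma) / 2) (Heps : 0 < eps).
Variables (w : nat -> seq A) (Hw : word_list w).

Let memory : pred (seq A) := fun u => `[< memory_word P X u >].
Let c j : R := fine (P [set o | ends_in (selected w memory j) (path o)]).

Lemma hits_succ_cvg (U : seq (seq A)) (x : int -> A) (p : R) :
  (hits U x n)%:R / n%:R @[n --> \oo] --> p ->
  (hits U x n.+1)%:R / n.+1%:R @[n --> \oo] --> p.
Proof.
by move=> h; rewrite (cvg_shiftS (fun n => (hits U x n)%:R / n%:R : R)).
Qed.

Lemma all_hits_cvg_ae : {ae P, forall o, forall U, (hits U (path o) n)%:R / n%:R @[n --> \oo] -->
  fine (P [set z | ends_in U (path z)])}.
Proof. by apply: ae_forall_countable => U; exact: hits_cvg_ae. Qed.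

(** Words beyond index [J] are ignored, which makes the convergence of the
    tests uniform. *)
Lemma tests_settled (x : int -> A) J :
  (forall v : seq A, \forall n \near \oo, PTEST gamma beta x n v = memory v) ->
  \forall n \near \oo, forall i, (i <= J)%N -> PTEST gamma beta x n (w i) = memory (w i).
Proof.
move=> h.
have : \forall n \near \oo, forall i : 'I_J.+1, PTEST gamma beta x n (w i) = memory (w i).
  by apply: filter_forall => i; exact: h.
by apply: filterS => n hn i iJ; exact: (hn (Ordinal (iJ : (i < J.+1)%N))).
Qed.

Lemma theta_bounded (x : int -> A) J :
  1 - eps / 2 < c J ->
  (forall v : seq A, \forall n \near \oo, PTEST gamma beta x n v = memory v) ->
  (forall U, (hits U x n)%:R / n%:R @[n --> \oo] --> fine (P [set o | ends_in U (path o)])) ->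
  \forall n \near \oo, (theta gamma beta eps w x n <= J)%N.
Proof.
move=> cJ tests freq; have [w0 _ _ _] := Hw.
have := hits_succ_cvg (freq (selected w memory J)); rewrite -/(c J).
have gap : 0 < c J - (1 - eps / 2) by lra.
move=> /cvgrPdist_lt /(_ _ gap) close; near=> n; apply: theta_le => //.
  by near: n; exact: nbhs_infty_gt.
rewrite /enough (@eq_selected _ w (PTEST gamma beta x n) memory J J) //; last first.
  by near: n; exact: tests_settled.
have : `|c J - (hits (selected w memory J) x n.+1)%:R / n.+1%:R| < c J - (1 - eps / 2).
  by near: n.
by rewrite ltr_norml ltrD2l ltrN2 => /andP[_] /ltW.
Unshelve. all: by end_near. Qed.

Lemma estimates_cvg (a : A) : {ae P, forall o,
  `|q_hat gamma beta w (path o) n a - next_prob_given_past P X n a o|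
    @[n --> within [set n : nat | good_time gamma beta eps w (path o) n] \oo] --> (0 : R)}.
Proof.
have [w0 _ _ _] := Hw.
have eps2 : 0 < eps / 2 by rewrite divr_gt0.
have [J cJ] := memory_coverage HX Hfm Hw eps2.
apply: filterS2 (filterI (PTEST_ae HX Hstat Herg Hgamma Hbeta) all_hits_cvg_ae)
  (filterI (frequency_ratio_cvg_ae HX Hstat Herg) (past_positive_ae HX Hstat)).
move=> o [tests freq] [ratio pos].
apply/cvgrPdist_lt => e e0; rewrite near_withinE.
have ratios : \forall n \near \oo, forall i, (i <= J)%N -> 0 < word_prob P X (w i) ->
    `|next_prob P X a (w i) - frequency_ratio a (w i) (path o) n| < e.
  have : \forall n \near \oo, forall i : 'I_J.+1, 0 < word_prob P X (w i) ->
      `|next_prob P X a (w i) - frequency_ratio a (w i) (path o) n| < e.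
    apply: filter_forall => i; have [pi|pi] := ltP 0 (word_prob P X (w i)); last first.
      by apply: nearW => n.
    by have /cvgrPdist_lt /(_ _ e0) := ratio a _ pi; apply: filterS => n h _.
  by apply: filterS => n hn i iJ; exact: (hn (Ordinal (iJ : (i < J.+1)%N))).
near=> n => /= good.
have settled : forall i, (i <= J)%N -> PTEST gamma beta (path o) n (w i) = memory (w i).
  by near: n; exact: tests_settled.
have thJ : (theta gamma beta eps w (path o) n <= J)%N.
  by near: n; exact: theta_bounded.
have long : (\max_(i < J.+1) size (w i) <= n)%N by near: n; exact: nbhs_infty_ge.
move: good; rewrite good_timeE // has_selected => /hasP[i].
rewrite mem_iota add0n ltnS => /= ith /andP[Pi oi].
have [ki Pk bk] := kappa_minimal Pi oi.
set k := kappa _ _ _ _ _ in ki Pk bk.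
have kJ : (k <= J)%N by rewrite (leq_trans ki) // (leq_trans ith).
have sk : (size (w k) <= n)%N.
  by apply: leq_trans long; exact: (leq_bigmax (Ordinal (kJ : (k < J.+1)%N))).
have ok : occ (w k) (path o) n.+1.
  rewrite occE; last by rewrite (leq_trans sk).
  by rewrite -[X in _ == X]bk; apply/eqP; congr (block _ _ _); lia.
rewrite q_hatE // -/k -/(frequency_ratio a (w k) _ n).
rewrite (next_prob_given_pastE HX Hstat _ _ ok) //; last first.
  by rewrite -[`[< _ >]]settled.
rewrite sub0r normrN normr_id distrC.
have ratios_n : forall i, (i <= J)%N -> 0 < word_prob P X (w i) ->
    `|next_prob P X a (w i) - frequency_ratio a (w i) (path o) n| < e by near: n.
apply: ratios_n => //; apply: lt_le_trans (pos n.+1) _.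
exact: word_prob_suffix.
Unshelve. all: by end_near. Qed.

Lemma good_times_density : {ae P, forall o,
  ((1 - eps)%:E <= limn_einf (fun n : nat =>
    ((count (good_time gamma beta eps w (path o)) (iota 0 n))%:R / n%:R)%:E))%E}.
Proof.
have [w0 _ _ _] := Hw.
have eps2 : 0 < eps / 2 by rewrite divr_gt0.
have [J cJ] := memory_coverage HX Hfm Hw eps2.
have exj : exists j, 1 - eps <= c j by exists J; rewrite /c; lra.
have [j cj jmin] := ex_minnP exj.
apply: filterS2 (PTEST_ae HX Hstat Herg Hgamma Hbeta) all_hits_cvg_ae => o tests freq.
have jJ : (j <= J)%N by apply: jmin; rewrite /c; lra.
(* Indices below [j] stay below the level [1 - eps / 2], hence are not reached by [theta]. *)
have scarce : \forall n \near \oo, forall i : 'I_j,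
    (hits (selected w memory i) (path o) n.+1)%:R / n.+1%:R < 1 - eps / 2.
  apply: filter_forall => i.
  have ci : c i < 1 - eps by rewrite ltNge; apply/negP => /jmin; rewrite leqNgt ltn_ord.
  have /cvgrPdist_lt /(_ _ eps2) := hits_succ_cvg (freq (selected w memory i)).
  rewrite -/(c i); apply: filterS => n; rewrite ltr_norml => /andP[+ _].
  rewrite ltrBrDr addrC ltrBlDr => h; apply: (lt_trans h).
  by rewrite -ltrBrDr (_ : 1 - eps / 2 - eps / 2 = 1 - eps) //; lra.
have [N _ regime] : \forall n \near \oo, has (fun u => occ u (path o) n.+1) (selected w memory j) ->
    good_time gamma beta eps w (path o) n.
  near=> n.
  have settled : forall i, (i <= J)%N -> PTEST gamma beta (path o) n (w i) = memory (w i).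
    by near: n; exact: tests_settled.
  have thJ : (theta gamma beta eps w (path o) n <= J)%N.
    by near: n; exact: theta_bounded.
  have jth : (j <= theta gamma beta eps w (path o) n)%N.
    apply: theta_ge => //; first by rewrite (leq_trans jJ) //; near: n; exact: nbhs_infty_ge.
    move=> i ij; rewrite /enough -ltNge.
    rewrite (@eq_selected _ w (PTEST gamma beta (path o) n) memory J i) //; last first.
      by rewrite (leq_trans (ltnW ij)).
    have h : forall i : 'I_j, (hits (selected w memory i) (path o) n.+1)%:R / n.+1%:R < 1 - eps / 2.
      by near: n.
    exact: (h (Ordinal ij)).
  rewrite good_timeE // !has_selected => /hasP[i]; rewrite mem_iota add0n ltnS => ij /andP[mi oi].
  apply/hasP; exists i; first by rewrite mem_iota add0n ltnS (leq_trans ij).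
  by rewrite settled ?mi // (leq_trans ij).
apply: le_trans (_ : ((c j)%:E <= _)%E); first by rewrite lee_fin.
(* The truncated difference discards the first [N] times, before the regime is reached. *)
apply: (@limn_einf_ge _ _ (fun n => (hits (selected w memory j) (path o) n - N)%N%:R / n%:R)).
  move=> n; rewrite ler_wpM2r ?invr_ge0 // ler_nat leq_subLR addnC.
  by apply: count_le_after => t Nt; exact: regime.
apply: (@cvg_ratio_bounded_diff R _ _ N _ _ _ (freq (selected w memory j))) => n; lia.
Unshelve. all: by end_near. Qed.

End main_proof.

Theorem corollary1 (d : measure_display) (Omega : measurableType d)
    (R : realType) (P : probability Omega R) (A : countType)
    (X : int -> Omega -> A)
    (HX : discrete_process X) (Hstat : stationary P X) (Herg : ergodic P X)
    (Hfm : finitarily_markovian P X)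
    (gamma beta eps : R)
    (Hgamma : 0 < gamma < 1) (Hbeta : 0 < beta < (1 - gamma) / 2)
    (Heps : 0 < eps)
    (w : nat -> seq A) (Hw : word_list w) :
  (forall a : A,
     {ae P, forall o,
        `|q_hat gamma beta w (sample_path X o) n a
          - next_prob_given_past P X n a o|
          @[n --> within [set n : nat
              | good_time gamma beta eps w (sample_path X o) n] \oo]
        --> (0 : R)})
  /\
  {ae P, forall o,
     ((1 - eps)%:E <=
      limn_einf (fun n : nat =>
        ((count (good_time gamma beta eps w (sample_path X o)) (iota 0 n))%:R
          / n%:R)%:E))%E}.
Proof.
split; last exact: good_times_density.
by move=> a; apply: estimates_cvg.
Qed.
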